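(* Let $F(X)=X^5+a_4X^4+a_3X^3+a_2X^2+a_1X+a_0$ with $a_0,\dots,a_4\in\mathbb{Z}$ be such that $Y^2=F(X)$ defines a hyperelliptic curve $C$ of genus $2$ over $\mathbb{Q}$. Let $P=(x_P,y_P)$ with $x_P,y_P\in\mathbb{Z}$ be an integral point on $C\setminus\{\infty\}$, let $D_P=[P]-[\infty]\in \mathrm{Jac}(C)(\mathbb{Q})$, and let $c_n=\psi_n(x_P)\in\mathbb{Z}$ for $n\in\mathbb{Z}$, where $\psi_n(X)\in\mathbb{Z}[X]$ is the $n$-th Cantor division polynomial of $C$. Assume that $c_3c_4c_5c_6c_7(c_4^3-c_3^3c_5)\neq 0$. Let $p$ be an odd prime which divides neither $\mathrm{disc}(F)$ nor $c_3c_4c_5c_6c_7(c_4^3-c_3^3c_5)$. Then: (1) The reduction modulo $p$ of the sequence $\boldsymbol{c}=\{c_n\}_{n\in\mathbb{Z}}$ is periodic. (2) Let $\mathrm{Per}_p(\boldsymbol{c})$ be the period of the reduction modulo $p$ of $\boldsymbol{c}$, and let $\mathrm{ord}_p(D_P)$ be the order of the reduction $\overline{D_P}\in \mathrm{Jac}(C)(\mathbb{F}_p)$ of $D_P$ modulo $p$. Then $$\mathrm{ord}_p(D_P)\ \mid\ \mathrm{Per}_p(\boldsymbol{c})\ \mid\ (p-1)\,\mathrm{ord}_p(D_P).$$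
   Context: $C$ is the smooth projective curve with affine equation $Y^2=F(X)$ ($\mathrm{disc}(F)\neq0$), with unique point at infinity $\infty$, and $\mathrm{Jac}(C)$ is its Jacobian. For an odd prime $p\nmid \mathrm{disc}(F)$, $C$ and $\mathrm{Jac}(C)$ have good reduction at $p$; $\mathrm{Jac}(C)(\mathbb{F}_p)$ denotes the $\mathbb{F}_p$-points of the Jacobian of the reduced curve, and $\overline{D_P}=[\overline P]-[\infty]$ with $\overline P$ the reduction of $P$. Cantor's division polynomials: let $S(z)=-\sqrt{F(X-z)}$ be the power series in $z$ with $S(z)^2=F(X-z)$ and constant term $-Y$, where $Y^2=F(X)$. For $j\ge1$ its $z^j$-coefficient has the form $P_j(X)\,(2Y)^{1-2j}$ with $P_j(X)\in\mathbb{Z}[a_0,\dots,a_4][X]$. Put $\psi_0=\psi_1=0$ and, for every integer $N\ge0$, $\psi_{2N+2}(X)=\det\big(P_{3+i+j}(X)\big)_{0\le i,j\le N-1}$ and $\psi_{2N+3}(X)=4F(X)\det\big(P_{4+i+j}(X)\big)_{0\le i,j\le N-1}$ (empty determinant $=1$), and $\psi_{-n}=-\psi_n$. In particular $\psi_2=1$, $\psi_3=4F$. A sequence $\{b_n\}_{n\in\mathbb{Z}}$ is periodic if there is $s\ge1$ with $b_{n+s}=b_n$ for all $n\in\mathbb{Z}$; its period is the least such $s$. *)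

(* Defs.v *)
From HB Require Import structures.
From mathcomp Require Import all_boot all_order all_algebra all_field.
From mathcomp Require Import generic_quotient ring_quotient.
From mathcomp Require Import freeg.
From mathcomp Require Import boolp.
From mathcomp Require Import ring zify.

Set Implicit Arguments.
Unset Strict Implicit.
Unset Printing Implicit Defensive.

Import Order.TTheory GRing.Theory Num.Theory.

Local Open Scope ring_scope.

(* [least Q] is 0 when no natural number satisfies Q. *)
Definition least (Q : nat -> Prop) : nat :=
  if pselect (exists n, `[< Q n >]) is left exQ then ex_minn exQ else 0%N.

Lemma leastP (Q : nat -> Prop) (n : nat) :
  Q n -> Q (least Q) /\ (least Q <= n)%N.
Proof.
move=> Qn; rewrite /least; case: pselect => [exQ|[]]; last first.
  by exists n; apply/asboolP.
by case: ex_minnP => m /asboolP Qm min_m; split=> //; apply/min_m/asboolP.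
Qed.

Definition is_period (T : Type) (b : int -> T) (s : nat) : Prop :=
  (0 < s)%N /\ forall n : int, b (n + s%:Z) = b n.

Definition periodic (T : Type) (b : int -> T) : Prop :=
  exists s, is_period b s.

Definition period (T : Type) (b : int -> T) : nat := least (is_period b).

(* The order of x in an additive group; 0 stands for infinite order. *)
Definition zorder (V : zmodType) (x : V) : nat :=
  least (fun n => (0 < n)%N /\ x *+ n = 0).

Definition reduce_seq (p : nat) (c : int -> int) : int -> 'F_p :=
  fun n => (c n)%:~R.

Definition quintic (a : 'I_5 -> int) : {poly int} :=
  'X^5 + \sum_(i < 5) a i *: 'X^i.

Definition disc (F : {poly int}) : int :=
  (-1) ^+ 'C((size F).-1, 2) * resultant F F^`().

Section CantorPolynomials.

Variable F : {poly int}.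

(* F(X - z), as a polynomial in z (the outer variable) over Z[X]. *)
Definition shifted : {poly {poly int}} := map_poly polyC F \Po ('X%:P - 'X).

(* Comparing the coefficients of z^m in S(z)^2 = F(X - z), where              *)
(* S(z) = - Y + \sum_(j >= 1) P_j (2Y)^(1-2j) z^j and Y^2 = F, and multiplying *)
(* by (2Y)^(2m-2) = (4F)^(m-1) gives, for m >= 1,                             *)
(*   - P_m + \sum_(1 <= i < m) P_i P_(m-i) = (4F)^(m-1) [z^m] F(X - z).       *)
(* The term of index 0 below is a dummy. sqrt_seriesP and sqrt_series_unique  *)
(* show that these are the only P_j satisfying the defining equation of S.    *)
Fixpoint cantorPs (n : nat) : seq {poly int} :=
  if n is m.+1 then
    let s := cantorPs m in
    rcons s (\sum_(1 <= i < m) s`_i * s`_(m - i)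
               - (4 *: F) ^+ m.-1 * shifted`_m)
  else [::].

Definition cantorP (j : nat) : {poly int} := (cantorPs j.+1)`_j.

Definition hankelP (k N : nat) : {poly int} :=
  \det (\matrix_(i < N, j < N) cantorP (k + i + j)).

Definition psi_nat (n : nat) : {poly int} :=
  if n is k.+2 then
    if odd k then 4 *: F * hankelP 4 k./2 else hankelP 3 k./2
  else 0.

Definition psi (n : int) : {poly int} :=
  match n with Posz m => psi_nat m | Negz m => - psi_nat m.+1 end.

Lemma psi_nat2 : psi_nat 2 = 1.
Proof. exact: det_mx00. Qed.

Lemma psi_nat3 : psi_nat 3 = 4 *: F.
Proof. by rewrite /psi_nat /= [hankelP _ _]det_mx00 mulr1. Qed.

Lemma size_cantorPs n : size (cantorPs n) = n.
Proof. by elim: n => //= n IHn; rewrite size_rcons IHn. Qed.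

Lemma nth_cantorPs n j : (j < n)%N -> (cantorPs n)`_j = cantorP j.
Proof.
elim: n => // n IHn; rewrite ltnS leq_eqVlt => /orP[/eqP->//|ltjn].
by rewrite /= nth_rcons size_cantorPs ltjn IHn.
Qed.

Lemma cantorPE m : cantorP m =
  \sum_(1 <= i < m) cantorP i * cantorP (m - i)
    - (4 *: F) ^+ m.-1 * shifted`_m.
Proof.
rewrite {1}/cantorP /= nth_rcons size_cantorPs ltnn eqxx; congr (_ - _).
rewrite !big_nat; apply: eq_bigr => i /andP[i_gt0 ltim].
by rewrite !nth_cantorPs // ltn_subrL i_gt0 (leq_ltn_trans _ ltim).
Qed.

Lemma shifted0 : shifted`_0 = F.
Proof.
rewrite -horner_coef0 horner_comp !hornerE subr0 -[RHS]comp_polyXr.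
by rewrite /comp_poly.
Qed.

Section Series.

Variables (K : fieldType) (phi : {rmorphism {poly int} -> K}) (y : K).
Hypotheses (y2 : y ^+ 2 = phi F) (y_neq0 : 2%:R * y != 0).

Definition sqrt_series (P : nat -> {poly int}) (j : nat) : K :=
  if j is 0%N then - y else phi (P j) * (2%:R * y) ^ (1 - 2 * j%:Z).

Let two_y_sqr : (2%:R * y) ^+ 2 = phi (4 *: F).
Proof.
by rewrite exprMn y2 -mul_polyC rmorphM /= -[4]/(4%:R) polyC_natr rmorph_nat -natrX.
Qed.

Let sqrt_series_gt0 P j : (0 < j)%N ->
  sqrt_series P j = phi (P j) * (2%:R * y) / (2%:R * y) ^+ j.*2.
Proof.
by case: j => // j _; rewrite /sqrt_series expfzDr // expr1z -PoszM mul2n -exprnN !mulrA.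
Qed.

Lemma sqrt_series_conv P m :
  \sum_(i < m.+2) sqrt_series P i * sqrt_series P (m.+1 - i)
  = (\sum_(1 <= i < m.+1) phi (P i) * phi (P (m.+1 - i)%N) - phi (P m.+1))
      / phi (4 *: F) ^+ m.
Proof.
have u2m : (2%:R * y) ^+ m.*2 = phi (4 *: F) ^+ m.
  by rewrite -two_y_sqr -exprM mul2n.
rewrite -(big_mkord xpredT (fun i => sqrt_series P i * sqrt_series P (m.+1 - i))).
have splitE (G : nat -> K) :
    \sum_(0 <= i < m.+2) G i = \sum_(1 <= i < m.+1) G i + (G 0%N + G m.+1).
  by rewrite big_nat_recr //= big_ltn // addrAC addrC.
rewrite splitE subn0 subnn -u2m mulrBl mulr_suml; congr (_ + _).
  rewrite !big_nat; apply: eq_bigr => i /andP[i_gt0 ltim].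
  rewrite !sqrt_series_gt0 ?subn_gt0 // subSn //.
  have -> : m.*2 = (i.*2 + (m - i).*2)%N by rewrite -doubleD subnKC.
  rewrite exprD doubleS !exprS; move: y_neq0; set u := 2%:R * y => u_neq0.
  by field; rewrite !expf_neq0.
rewrite !(sqrt_series_gt0 P (ltn0Sn m)) doubleS !exprS.
have [two_neq0 yn0] : 2%:R != 0 :> K /\ y != 0.
  by move: y_neq0; rewrite mulf_eq0 negb_or => /andP[].
change (sqrt_series P 0) with (- y); move: (expf_neq0 m.*2 y_neq0); set w := _ ^+ m.*2 => w_neq0.
by field; rewrite w_neq0 yn0 two_neq0.
Qed.

Lemma sqrt_seriesP m :
  \sum_(i < m.+1) sqrt_series cantorP i * sqrt_series cantorP (m - i)
  = phi shifted`_m.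
Proof.
case: m => [|m].
  by rewrite big_ord1 subnn mulrNN -expr2 y2 shifted0.
rewrite sqrt_series_conv cantorPE rmorphB rmorph_sum /= rmorphM rmorphXn /=.
under eq_bigr do rewrite -rmorphM.
rewrite opprB addrCA subrr addr0 mulrAC divff ?mul1r //.
by rewrite expf_neq0 // -two_y_sqr expf_neq0.
Qed.

Lemma sqrt_series_unique (P : nat -> {poly int}) : injective phi ->
    (forall m, \sum_(i < m.+1) sqrt_series P i * sqrt_series P (m - i)
               = phi shifted`_m) ->
  forall j, (0 < j)%N -> P j = cantorP j.
Proof.
move=> phi_inj sqrtP; elim/ltn_ind => -[//|m] IHm _.
have := sqrtP m.+1; rewrite -sqrt_seriesP !sqrt_series_conv => /mulIf eqP.
apply/phi_inj/oppr_inj; move: eqP.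
rewrite (eq_big_nat _ _ (F2 := fun i => phi (cantorP i) * phi (cantorP (m.+1 - i)))).
  by move=> eqP; apply: addrI (eqP _); rewrite invr_eq0 expf_neq0 // -two_y_sqr expf_neq0.
by move=> i /andP[i_gt0 ltim]; rewrite !IHm ?subn_gt0 // ltn_subrL i_gt0.
Qed.

End Series.

End CantorPolynomials.

Section Curve.

Variables (a : 'I_5 -> int) (L : fieldType).

Definition curve_poly : {poly L} := map_poly intr (quintic a).

(* The points over L of the smooth projective curve Y^2 = F(X); None is the   *)
(* unique point at infinity.                                                  *)
Definition point := option {q : L * L | q.2 ^+ 2 == curve_poly.[q.1]}.

Definition divisor := {freeg point / int}.

Definition curve_eqn : {poly {poly L}} := 'X^2 - curve_poly%:P.

(* The coordinate ring of the affine part; the outer variable is Y. *)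
Definition coord_ring := {poly %/ curve_eqn}.

Implicit Types (g h s t : coord_ring) (q : L * L).

Definition fun_X : coord_ring := qpolyC _ 'X.
Definition fun_Y : coord_ring := in_qpoly _ 'X.

(* The coefficient of Y^k, a polynomial in X. *)
Definition coefY g (k : nat) : {poly L} := (g : {poly {poly L}})`_k.

Definition eval g q : L := (g : {poly {poly L}}).[q.2%:P].[q.1].

(* X - x is a local parameter at (x, y) when y != 0, and Y is one at (x, 0).  *)
Definition local_param q : coord_ring :=
  if q.2 == 0 then fun_Y else fun_X - qpolyC _ q.1%:P.

(* g = u^d s/t with u a local parameter and s/t a unit of the local ring at q. *)
Definition affine_order g q (d : nat) : Prop :=
  exists s t, [/\ eval s q != 0, eval t q != 0 & t * g = local_param q ^+ d * s].

(* X and Y have poles of order 2 and 5 at infinity, so that the monomials     *)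
(* X^i and X^j Y have pairwise distinct pole orders.                          *)
Definition pole_order g : nat :=
  \max_(k < 2 | coefY g k != 0%R) (2 * (size (coefY g k)).-1 + 5 * k)%N.

Definition order_at g (P : point) (d : int) : Prop :=
  match P with
  | Some q => exists2 n : nat, d = n%:Z & affine_order g (val q) n
  | None => d = - (pole_order g)%:Z
  end.

(* D is the divisor of the nonzero rational function g/h. *)
Definition is_div g h (D : divisor) : Prop :=
  [/\ g != 0, h != 0 & forall P, exists m n,
      [/\ order_at g P m, order_at h P n & coeff P D = m - n]].

Definition degree0 : pred divisor := fun D => deg D == 0.

Lemma degree0_zmod_closed : zmod_closed degree0.
Proof.
split=> [|D E]; rewrite !unfold_in /degree0 ?deg0 // degB.
by move=> /eqP-> /eqP->; rewrite subrr.
Qed.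

HB.instance Definition _ :=
  GRing.isZmodClosed.Build divisor degree0 degree0_zmod_closed.

Record div0 := Div0 { div0_val :> divisor; _ : div0_val \in degree0 }.

HB.instance Definition _ := [isSub for div0_val].
HB.instance Definition _ := [Choice of div0 by <:].
HB.instance Definition _ := [SubChoice_isSubZmodule of div0 by <:].

Definition principal : pred div0 :=
  fun D => `[< exists g h, is_div g h (val D) >].

Lemma size_quintic_tail : (size (\sum_(i < 5) a i *: 'X^i)%R <= 5)%N.
Proof.
apply: (leq_trans (size_sum _ _ _)); apply/bigmax_leqP => i _.
by rewrite (leq_trans (size_scale_leq _ _)) // size_polyXn.
Qed.

Lemma size_quintic : size (quintic a) = 6.
Proof. by rewrite size_polyDl size_polyXn // ltnS size_quintic_tail. Qed.

Lemma quintic_monic : quintic a \is monic.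
Proof.
rewrite monicE lead_coefDl ?lead_coefXn // size_polyXn ltnS.
exact: size_quintic_tail.
Qed.

Lemma curve_poly_monic : curve_poly \is monic.
Proof. exact/monic_map/quintic_monic. Qed.

Lemma size_curve_poly : size curve_poly = 6.
Proof.
rewrite size_map_poly_id0 ?size_quintic //.
by rewrite (monicP quintic_monic) rmorph1 oner_neq0.
Qed.

Lemma curve_eqn_monic : curve_eqn \is monic.
Proof. exact: monicXnsubC. Qed.

Lemma size_curve_eqn : size curve_eqn = 3.
Proof. exact: size_XnsubC. Qed.

Lemma mk_monic_curve : mk_monic curve_eqn = curve_eqn.
Proof. by rewrite /mk_monic size_curve_eqn curve_eqn_monic. Qed.

Lemma coord_ringE g : g = (coefY g 0)%:P + coefY g 1 *: 'X :> {poly {poly L}}.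
Proof.
have szg : (size (g : {poly {poly L}}) <= 2)%N.
  by rewrite (leq_trans (size_npoly g)) // mk_monic_curve size_curve_eqn.
apply/polyP => -[|[|i]]; rewrite coefD coefC coefZ coefX /= ?mulr0 ?addr0 //.
  by rewrite mulr1 add0r.
by rewrite nth_default // (leq_trans szg).
Qed.

Lemma coord_ring_eq0 g : (g == 0) = (coefY g 0 == 0) && (coefY g 1 == 0).
Proof.
apply/eqP/andP => [->|[/eqP g0 /eqP g1]]; first by rewrite /coefY /= !coef0.
by apply: val_inj; rewrite /= coord_ringE g0 g1 scale0r addr0.
Qed.

Lemma coord_ringM g g' :
  g * g' = (coefY g 0 * coefY g' 0 + coefY g 1 * coefY g' 1 * curve_poly)%:P
           + (coefY g 0 * coefY g' 1 + coefY g 1 * coefY g' 0) *: 'X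
  :> {poly {poly L}}.
Proof.
transitivity (Pdiv.CommonRing.rmodp
    (((coefY g 0)%:P + coefY g 1 *: 'X) * ((coefY g' 0)%:P + coefY g' 1 *: 'X)) curve_eqn).
  by rewrite poly_of_qpolyM -!coord_ringE; congr Pdiv.CommonRing.rmodp; apply: mk_monic_curve.
set b0 := coefY g 0; set b1 := coefY g 1.
set c0 := coefY g' 0; set c1 := coefY g' 1.
set r := RHS.
rewrite (_ : _ * _ = (b1 * c1)%:P * curve_eqn + r); last first.
  rewrite /r /curve_eqn -!mul_polyC !polyCD !polyCM; ring.
rewrite Pdiv.RingMonic.rmodp_addl_mul_small ?curve_eqn_monic //.
rewrite size_curve_eqn (leq_ltn_trans (size_polyD _ _)) // gtn_max.
rewrite (leq_ltn_trans (size_polyC_leq1 _)) //.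
by rewrite (leq_ltn_trans (size_scale_leq _ _)) // size_polyX.
Qed.

Lemma coefYM g g' :
  coefY (g * g') 0 = coefY g 0 * coefY g' 0 + coefY g 1 * coefY g' 1 * curve_poly
  /\ coefY (g * g') 1 = coefY g 0 * coefY g' 1 + coefY g 1 * coefY g' 0.
Proof.
by rewrite /coefY coord_ringM !coefD !coefC !coefZ !coefX /= mulr0 addr0 mulr1 add0r.
Qed.

Lemma evalE g q : eval g q = (coefY g 0).[q.1] + (coefY g 1).[q.1] * q.2.
Proof. by rewrite /eval {1}coord_ringE !hornerE. Qed.

Lemma evalM g g' q : q.2 ^+ 2 == curve_poly.[q.1] ->
  eval (g * g') q = eval g q * eval g' q.
Proof.
move=> /eqP eq_q; have [E0 E1] := coefYM g g'.
rewrite !evalE E0 E1 !hornerE -eq_q; ring.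
Qed.

Lemma eval1 q : eval 1 q = 1.
Proof. by rewrite /eval /= !hornerE. Qed.

Definition coord_norm g : {poly L} :=
  coefY g 0 ^+ 2 - coefY g 1 ^+ 2 * curve_poly.

Lemma coord_normM g g' : coord_norm (g * g') = coord_norm g * coord_norm g'.
Proof.
by rewrite /coord_norm; have [-> ->] := coefYM g g'; ring.
Qed.

Let size_sq (u : {poly L}) : u != 0 -> size (u ^+ 2) = ((size u).-1.*2).+1.
Proof.
move=> u0; rewrite expr2 size_mul // addnn -[in LHS](prednK (n := size u)) //.
by rewrite size_poly_gt0.
Qed.

Let size_sq_curve (u : {poly L}) :
  u != 0 -> size (u ^+ 2 * curve_poly) = ((size u).-1.*2 + 6)%N.
Proof.
move=> u0; have f0 : curve_poly != 0 by rewrite -size_poly_gt0 size_curve_poly.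
by rewrite size_mul ?expf_neq0 // size_sq // size_curve_poly addSn.
Qed.

Let pole_orderE g : pole_order g =
  maxn (if coefY g 0 != 0 then (size (coefY g 0)).-1.*2 else 0)
       (if coefY g 1 != 0 then ((size (coefY g 1)).-1.*2 + 5)%N else 0).
Proof.
rewrite /pole_order big_mkcond /= !big_ord_recl big_ord0 maxn0 /=.
by rewrite !mul2n muln0 addn0 muln1.
Qed.

Lemma coord_norm_pole g : g != 0 -> size (coord_norm g) = (pole_order g).+1.
Proof.
rewrite coord_ring_eq0 negb_and pole_orderE /coord_norm.
have [-> /= b1|b0 _] := eqVneq (coefY g 0) 0.
  by rewrite b1 expr0n /= sub0r size_polyN size_sq_curve // max0n addnS.
have [->|b1] /= := eqVneq (coefY g 1) 0.
  by rewrite expr0n /= mul0r subr0 size_sq // maxn0.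
move: (size_sq b0) (size_sq_curve b1).
move: (_.-1.*2) (_.-1.*2) (odd_double (size (coefY g 0)).-1)
  (odd_double (size (coefY g 1)).-1).
move=> m n odd_n odd_m szA szB.
have [lt_AB|le_BA] := ltnP (size (coefY g 0 ^+ 2)) (size (coefY g 1 ^+ 2 * curve_poly)).
  by rewrite addrC size_polyDl size_polyN // szB; move: lt_AB; rewrite szA szB; lia.
have {le_BA} lt_BA : (m + 6 < n.+1)%N by move: le_BA; rewrite szA szB; lia.
by rewrite size_polyDl ?size_polyN szA ?szB //; lia.
Qed.

Lemma coord_norm_eq0 g : (coord_norm g == 0) = (g == 0).
Proof.
apply/idP/eqP => [|->]; last first.
  by rewrite /coord_norm /coefY /= !coef0 expr0n /= mul0r subrr.
by apply: contraTeq => /coord_norm_pole szg; rewrite -size_poly_gt0 szg.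
Qed.

Lemma coord_mul_neq0 g g' : g != 0 -> g' != 0 -> g * g' != 0.
Proof.
by rewrite -!coord_norm_eq0 coord_normM mulf_eq0 negb_or => -> ->.
Qed.

Lemma pole_orderM g g' : g != 0 -> g' != 0 ->
  pole_order (g * g') = (pole_order g + pole_order g')%N.
Proof.
move=> g0 g'0; apply: succn_inj; rewrite -coord_norm_pole ?coord_mul_neq0 //.
by rewrite coord_normM size_mul ?coord_norm_eq0 // !coord_norm_pole // addnS.
Qed.

Lemma order_atM g g' P m n : g != 0 -> g' != 0 ->
  order_at g P m -> order_at g' P n -> order_at (g * g') P (m + n).
Proof.
move=> g0 g'0; case: P => [[q eq_q]|] /= => [[i -> [s [t [s0 t0 tg]]]]|-> ->]; last first.
  by rewrite pole_orderM // PoszD opprD.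
move=> [j -> [s' [t' [s'0 t'0 tg']]]]; exists (i + j)%N => //.
exists (s * s'), (t * t'); rewrite !evalM // !mulf_neq0 //; split=> //.
by rewrite mulrACA tg tg' exprD mulrACA.
Qed.

Lemma pole_order1 : pole_order 1 = 0%N.
Proof.
apply: succn_inj; rewrite -coord_norm_pole ?oner_neq0 //.
by rewrite /coord_norm /coefY /= !coefC /= expr1n expr0n mul0r subr0 size_poly1.
Qed.

Lemma is_div1 : is_div 1 1 0.
Proof.
split; rewrite ?oner_neq0 // => P; exists 0, 0; rewrite coeff0 subrr.
have ord1 : order_at 1 P 0.
  case: P => [q|] /=; last by rewrite pole_order1 oppr0.
  by exists 0%N => //; exists 1, 1; rewrite eval1 oner_neq0 expr0.
by split.
Qed.

Lemma is_divB g g' k k' D E :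
  is_div g g' D -> is_div k k' E -> is_div (g * k') (g' * k) (D - E).
Proof.
move=> [g0 g'0 divD] [k0 k'0 divE]; split; rewrite ?coord_mul_neq0 // => P.
have [m [n [gm g'n cD]]] := divD P; have [i [j [ki k'j cE]]] := divE P.
exists (m + j), (n + i); rewrite coeffB cD cE; split; [exact: order_atM..|ring].
Qed.

Lemma principal_zmod_closed : zmod_closed principal.
Proof.
split=> [|D E]; first by apply/asboolP; exists 1, 1; apply: is_div1.
move=> /asboolP[g [g' divD]] /asboolP[k [k' divE]]; apply/asboolP.
by exists (g * k'), (g' * k); apply: is_divB.
Qed.

HB.instance Definition _ :=
  GRing.isZmodClosed.Build div0 principal principal_zmod_closed.

(* Jac(L) = Pic^0 of the curve over L. *)
Definition jacobian :=
  Quotient.quot (GRing.ZmodClosed.clone div0 principal _).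

HB.instance Definition _ := GRing.Zmodule.on jacobian.

Definition div_class (D : div0) : jacobian := \pi_jacobian%qT D.

Lemma div_classB : {morph div_class : D E / D - E}.
Proof. by move=> D E; rewrite /div_class !piE. Qed.

Lemma div_class_eq0 D : (div_class D == 0) = (D \in principal).
Proof.
rewrite -[D in RHS]subr0 Quotient.idealrBE.
by rewrite /div_class !piE.
Qed.

Lemma conj_pointP (sigma : {rmorphism L -> L}) (q : L * L) :
  q.2 ^+ 2 == curve_poly.[q.1] ->
  (sigma q.2) ^+ 2 == curve_poly.[sigma q.1].
Proof.
move=> /eqP eq_q; rewrite -rmorphXn eq_q -horner_map /= -map_poly_comp /=.
by rewrite (eq_map_poly (g := intr)) // => z /=; rewrite rmorph_int.
Qed.

Definition conj_point (sigma : {rmorphism L -> L}) (P : point) : point :=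
  if P is Some q then
    Some (exist _ (sigma (val q).1, sigma (val q).2) (conj_pointP sigma (valP q)))
  else None.

Definition conj_div (sigma : {rmorphism L -> L}) : divisor -> divisor :=
  fglift (fun P => << conj_point sigma P >>).

Lemma conj_divB sigma : {morph conj_div sigma : D E / D - E}.
Proof. exact: lift_is_additive. Qed.

Lemma conj_div0 sigma : conj_div sigma 0 = 0.
Proof. by rewrite -{1}(subrr 0) conj_divB subrr. Qed.

(* The classes fixed by every field endomorphism of L. *)
Definition galois_fixed : pred jacobian := fun c =>
  `[< forall sigma : {rmorphism L -> L}, exists D E : div0,
      [/\ c = div_class D, c = div_class E & val E = conj_div sigma (val D)] >].

Lemma galois_fixed_zmod_closed : zmod_closed galois_fixed.
Proof.
have class0 : 0 = div_class 0 by apply/esym/eqP; rewrite div_class_eq0 rpred0.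
split=> [|c c' /asboolP fix_c /asboolP fix_c']; apply/asboolP => sigma.
  by exists 0, 0; rewrite /= conj_div0.
have [D [E [cD cE DE]]] := fix_c sigma.
have [D' [E' [cD' cE' DE']]] := fix_c' sigma.
exists (D - D'), (E - E').
by rewrite !div_classB -cD -cE -cD' -cE' /= conj_divB -DE -DE'.
Qed.

HB.instance Definition _ :=
  GRing.isZmodClosed.Build jacobian galois_fixed galois_fixed_zmod_closed.

Record rat_jacobian :=
  RatJacobian { rat_jacobian_val :> jacobian; _ : rat_jacobian_val \in galois_fixed }.

HB.instance Definition _ := [isSub for rat_jacobian_val].
HB.instance Definition _ := [Choice of rat_jacobian by <:].
HB.instance Definition _ := [SubChoice_isSubZmodule of rat_jacobian by <:].

Section ReducedPoint.

Variables xP yP : int.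
Hypothesis P_on_C : yP ^+ 2 = (quintic a).[xP].

Lemma reduced_pointP :
  (yP%:~R : L) ^+ 2 == curve_poly.[xP%:~R].
Proof. by rewrite horner_map /= -P_on_C rmorphXn. Qed.

Definition reduced_point : point :=
  Some (exist _ (xP%:~R : L, yP%:~R : L) reduced_pointP).

Lemma reduced_div_degree0 :
  (<< reduced_point >> - << None >> : divisor) \in degree0.
Proof. by rewrite unfold_in /degree0 degB !degU subrr. Qed.

(* [P] - [infinity] *)
Definition reduced_div : div0 := Div0 reduced_div_degree0.

Lemma reduced_class_fixed : div_class reduced_div \in galois_fixed.
Proof.
apply/asboolP => sigma; exists reduced_div, reduced_div; split=> //=.
rewrite conj_divB /conj_div !liftU !scale1r /=; congr (<< _ >> - _).
by congr Some; apply: val_inj; rewrite /= !rmorph_int.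
Qed.

Definition reduced_class : rat_jacobian := RatJacobian reduced_class_fixed.

End ReducedPoint.

End Curve.

Definition Fpbar (p : nat) : countClosedFieldType :=
  tag (countable_algebraic_closure 'F_p).

(* Every field endomorphism of the algebraic closure of F_p is an             *)
(* automorphism over F_p, so galois_fixed is Galois invariance here.          *)
Definition jacobian_Fp (a : 'I_5 -> int) (p : nat) : zmodType :=
  rat_jacobian a (Fpbar p).

Definition DPbar (a : 'I_5 -> int) (p : nat) (xP yP : int)
    (P_on_C : yP ^+ 2 = (quintic a).[xP]) : jacobian_Fp a p :=
  reduced_class (Fpbar p) P_on_C.

(* Main.v *)
Require Import Defs.
From HB Require Import structures.
From mathcomp Require Import all_boot all_order all_fingroup all_algebra all_field.
From mathcomp Require Import generic_quotient freeg boolp.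
From mathcomp Require Import ring zify.

(* The order m of D_P is read off the zeros of c: away from a factor 2y, c_n  *)
(* is the determinant of the map sending a function on C with poles of order  *)
(* at most n + 1 at infinity, and no other pole, to its n-jet at P. Hence,    *)
(* for n >= 2, c_n = 0 iff n D_P is a class [Q] - [infinity], and then        *)
(* c_(n-1) = c_n = c_(n+1) = 0 iff n D_P = 0. Such an n >= 1 exists by the    *)
(* pigeonhole principle, applied to functions over F_p whose norm is v^n      *)
(* (v = X - x_P) times a polynomial of degree at most 2.                      *)
(*   Let g have divisor m (P - infinity). Multiplication by g relates the     *)
(* jet maps of index n and n + m, so that c_(n+m) = B A^n c_n for n >= 2. The *)
(* residues at P of p q omega / g, with omega = dX / 2Y, make the jet maps of *)
(* index n and m - n adjoint, so that c_(m-n) = - B A^(-n) c_n for            *)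
(* 2 <= n <= m - 2. Together these give c_(n+m) = B A^n c_n for all integers  *)
(* n, and B^2 = A^m; as A and B lie in F_p^*, (p - 1) m is a period.          *)

(** Both divisibilities rest on [cantor_tdet], which equates c_n, up to a power of the unit 2y, with
    the determinant [tdet] of the n-jets at P. Lower bound: a function with divisor n (P - infinity)
    exists over the closure of F_p iff n D_P = 0 ([generatesP], from [generates_principal] and
    [principal_generates]), and [generates_of_tdet] builds such a function from three consecutive
    zeros of [tdet]. Since c_(-1) = c_0 = c_1 = 0, a period t makes c vanish at t - 1, t and t + 1,
    so that m divides t ([zorder_dvd_period]). Upper bound: [tdet_shift] and [reflection] give the
    translation and reflection laws, which [quasi_period] extends to all integers. Iterated k times,
    translation by m multiplies c_n by B^k A^(nk) (A^m)^(k(k-1)/2), where A^m = B^2; for k = p - 1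
    this factor is 1 ([zorder_period]). That c_2, ..., c_7 are units modulo p makes 2y a unit,
    forces m > 7, and places A and B in F_p through quotients of terms of the sequence. That m is
    finite is [exists_generates]. *)

Set Implicit Arguments.
Unset Strict Implicit.
Unset Printing Implicit Defensive.

Import Order.TTheory GRing.Theory Num.Theory.

Local Open Scope ring_scope.

(** * Functions on the curve and their pole orders *)

Section XnDvd.

Variable K : fieldType.
Implicit Types p q : {poly K}.

Lemma dvd_XnP n p : reflect (forall k, (k < n)%N -> p`_k = 0) ('X^n %| p).
Proof.
rewrite /dvdp -Pdiv.IdomainMonic.take_poly_modp.
apply: (iffP eqP) => [p0 k ltkn|p0].
  by move: (congr1 (fun q : {poly K} => q`_k) p0); rewrite coef_take_poly ltkn coef0.
by apply/polyP => k; rewrite coef_take_poly coef0; case: ltnP => // /p0.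
Qed.

Lemma dvdp_congr d p q : d %| p - q -> (d %| p) = (d %| q).
Proof. by move=> dvd_pq; rewrite -[p in LHS](subrK q) dvdp_addr. Qed.

Lemma dvd_XnMl n p q : q`_0 != 0 -> ('X^n %| q * p) = ('X^n %| p).
Proof.
move=> q0; rewrite mulrC Gauss_dvdpl // coprimep_sym coprimep_expr // coprimepX.
by rewrite /root horner_coef0.
Qed.

Lemma Xn_neq0 n : 'X^n != 0 :> {poly K}.
Proof. by rewrite -size_poly_eq0 size_polyXn. Qed.

Lemma dvd_XnXn m n : ('X^m %| ('X^n : {poly K})) = (m <= n)%N.
Proof. by rewrite dvdp_Pexp2l // size_polyX. Qed.

(** The factor p, of degree at most k, absorbs at most k of the factors X. *)
Lemma dvd_Xn_small n k p q : p != 0 -> (size p <= k.+1)%N ->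
  'X^(n + k) %| p * q -> 'X^n %| q.
Proof.
move=> p_neq0 szp.
have [e [r r0 defp]] := multiplicity_XsubC p 0; rewrite subr0 in defp.
have {}r0 : r`_0 != 0 by move: r0; rewrite p_neq0 /root horner_coef0.
have r_neq0 : r != 0 by apply: contraNneq r0 => ->; rewrite coef0.
have le_ek : (e <= k)%N.
  move: szp; rewrite defp size_mul ?Xn_neq0 // size_polyXn addnS /=.
  by have := size_poly_gt0 r; rewrite r_neq0; move: (size r); lia.
rewrite defp -mulrA dvd_XnMl // => dvd_q.
rewrite -(dvdp_mul2l _ _ (Xn_neq0 e)) -exprD (dvdp_trans _ dvd_q) // dvd_XnXn.
by lia.
Qed.

End XnDvd.

Section Functions.

Variables (K : fieldType) (f : {poly K}).

(* (a, b) stands for the function a(v) + b(v) Y on the curve Y^2 = f(v). *)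
Definition cfun := ({poly K} * {poly K})%type.

Implicit Types p q r : cfun.

Definition cmul p q : cfun := (p.1 * q.1 + p.2 * q.2 * f, p.1 * q.2 + p.2 * q.1).
Definition cconj p : cfun := (p.1, - p.2).
Definition nrm p : {poly K} := p.1 ^+ 2 - p.2 ^+ 2 * f.
Definition scal (c : {poly K}) p : cfun := (c * p.1, c * p.2).

(* v and Y have poles of order 2 and 5 at infinity: the degree of wt p is the *)
(* pole order of p.                                                           *)
Definition wt p : {poly K} := (p.1 \Po 'X^2) + 'X^5 * (p.2 \Po 'X^2).

Lemma cmul_conj p : cmul p (cconj p) = (nrm p, 0).
Proof. by congr pair => /=; rewrite /nrm; ring. Qed.

Lemma conj_cmul p q : cconj (cmul p q) = cmul (cconj p) (cconj q).
Proof. by congr pair => /=; ring. Qed.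

Lemma conjK p : cconj (cconj p) = p.
Proof. by case: p => a b; rewrite /cconj /= opprK. Qed.

Lemma nrm_conj p : nrm (cconj p) = nrm p.
Proof. by rewrite /nrm /= sqrrN. Qed.

Lemma nrmM p q : nrm (cmul p q) = nrm p * nrm q.
Proof. by rewrite /nrm /=; ring. Qed.

Lemma nrm_scal c p : nrm (scal c p) = c ^+ 2 * nrm p.
Proof. by rewrite /nrm /=; ring. Qed.

Lemma cmul_is_linear p : linear (cmul p).
Proof.
move=> c q r; apply: injective_projections; rewrite /= -!mul_polyC; ring.
Qed.

HB.instance Definition _ p := GRing.isLinear.Build K cfun cfun _ (cmul p) (cmul_is_linear p).

Lemma wt_is_linear : linear wt.
Proof.
move=> c p q; rewrite /wt /= !comp_polyD !comp_polyZ mulrDr -scalerAr scalerDr.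
by rewrite addrACA.
Qed.

HB.instance Definition _ := GRing.isLinear.Build K cfun {poly K} _ wt wt_is_linear.

Lemma coef_wt p d : (wt p)`_d =
  if odd d then (if (d < 5)%N then 0 else p.2`_(d - 5)./2) else p.1`_d./2.
Proof.
rewrite /wt coefD coefXnM !coef_comp_poly_Xn // !dvdn2 !divn2.
case: ltnP => [lt5|ge5]; first by rewrite addr0; case: odd.
by rewrite oddB //= addbT negbK; case: odd; rewrite ?add0r ?addr0.
Qed.

Lemma coef_fst p i : p.1`_i = (wt p)`_i.*2.
Proof. by rewrite coef_wt odd_double doubleK. Qed.

Lemma coef_snd p i : p.2`_i = (wt p)`_(i.*2 + 5).
Proof. by rewrite coef_wt addnC oddD odd_double /= addKn doubleK. Qed.

Lemma wt_eq0 p : (wt p == 0) = (p == 0).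
Proof.
apply/eqP/eqP => [wt0|->]; last exact: linear0.
have p1 : p.1 = 0 by apply/polyP => i; rewrite coef_fst wt0 !coef0.
have p2 : p.2 = 0 by apply/polyP => i; rewrite coef_snd wt0 !coef0.
by case: p p1 p2 {wt0} => a b /= -> ->.
Qed.

Lemma size_fst p n : (size (wt p) <= n.*2)%N -> (size p.1 <= n)%N.
Proof.
move=> sz; apply/leq_sizeP => j lenj; rewrite coef_fst nth_default //.
by rewrite (leq_trans sz) // leq_double.
Qed.

Lemma size_snd p n : (size (wt p) <= n.*2 + 5)%N -> (size p.2 <= n)%N.
Proof.
move=> sz; apply/leq_sizeP => j lenj; rewrite coef_snd nth_default //.
by rewrite (leq_trans sz) // leq_add2r leq_double.
Qed.

Lemma wt_conj p : wt (cconj p) = wt p \Po (- 'X).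
Proof.
have sq : 'X^2 \Po (- 'X) = 'X^2 :> {poly K} by rewrite comp_Xn_poly sqrrN.
have odd5 : 'X^5 \Po (- 'X) = - 'X^5 :> {poly K}.
  by rewrite comp_Xn_poly exprNn -signr_odd expr1 mulN1r.
rewrite /wt comp_polyD comp_polyM -!comp_polyA sq odd5 /= -(scaleN1r p.2).
by rewrite comp_polyZ scaleN1r mulrN mulNr.
Qed.

Lemma size_wt_conj p : size (wt (cconj p)) = size (wt p).
Proof. by rewrite wt_conj size_comp_poly2 // size_polyN size_polyX. Qed.

Lemma wt_cmul p q : wt (cmul p q) = wt p * wt q
  + (p.2 * q.2 \Po 'X^2) * ((f \Po 'X^2) - 'X^10).
Proof.
rewrite /wt /= !comp_polyD !comp_polyM.
have -> : 'X^10 = 'X^5 * 'X^5 :> {poly K} by rewrite -exprD.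
ring.
Qed.

Hypothesis f_monic : f \is monic.
Hypothesis size_f : size f = 6.

(** Substituting T^2 for v and T^5 for Y respects Y^2 = f(v) up to f(T^2) - T^10, which has degree
    at most 8 because f is monic of degree 5. The correction term of [wt_cmul] thus stays below the
    product of the leading terms. *)
Lemma size_lead_wtM p q : p != 0 -> q != 0 ->
  size (wt (cmul p q)) = (size (wt p) + size (wt q)).-1 /\
  lead_coef (wt (cmul p q)) = lead_coef (wt p) * lead_coef (wt q).
Proof.
rewrite -!wt_eq0 => p0 q0; rewrite wt_cmul.
suff lt_sz : (size ((p.2 * q.2 \Po 'X^2) * ((f \Po 'X^2) - 'X^10))%R
              < size (wt p * wt q)%R)%N.
  by rewrite size_polyDl // lead_coefDl // size_mul // lead_coefM.
have sz_snd (r : cfun) : r.2 != 0 -> ((size r.2).-1.*2 + 6 <= size (wt r))%N.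
  move=> r0; rewrite leqNgt; apply/negP => sz.
  suff: (size r.2 <= (size r.2).-1)%N.
    by rewrite leqNgt prednK ?leqnn // size_poly_gt0.
  by apply: size_snd; move: sz; rewrite addnS ltnS.
have lt0 : (0 < size (wt p * wt q)%R)%N by rewrite size_poly_gt0 mulf_neq0.
have [->|p20] := eqVneq p.2 0; first by rewrite mul0r comp_poly0 mul0r size_poly0.
have [->|q20] := eqVneq q.2 0; first by rewrite mulr0 comp_poly0 mul0r size_poly0.
have := sz_snd _ p20; have := sz_snd _ q20; rewrite (size_mul p0 q0) => sp sq.
apply: leq_ltn_trans (size_polyMleq _ _) _.
have := size_comp_poly_leq (p.2 * q.2) 'X^2; rewrite (size_mul p20 q20) size_polyXn /=.
have : (size ((f \Po 'X^2) - 'X^10)%R <= 9)%N.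
  apply/leq_sizeP => j; rewrite coefB coefXn coef_comp_poly_Xn // dvdn2 divn2.
  move=> le9j; have [odd_j|even_j] /= := boolP (odd j).
    by rewrite (_ : _ == _ = false) ?subr0 //; apply/negP => /eqP ej; rewrite ej in odd_j.
  have [->|nej] := eqVneq j 10.
    by move: f_monic; rewrite monicE lead_coefE size_f /= => /eqP ->; rewrite subrr.
  by rewrite subr0 nth_default // size_f; lia.
have := size_poly_gt0 p.2; have := size_poly_gt0 q.2; rewrite p20 q20.
move: sp sq; move: (size p.2) (size q.2) (size (wt p)) (size (wt q)) => a b c d.
move: (size _) (size _) => e g; lia.
Qed.

Lemma size_wtM p q : p != 0 -> q != 0 ->
  size (wt (cmul p q)) = (size (wt p) + size (wt q)).-1.
Proof. by move=> p0 q0; case: (size_lead_wtM p0 q0). Qed.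

Lemma lead_wtM p q : p != 0 -> q != 0 ->
  lead_coef (wt (cmul p q)) = lead_coef (wt p) * lead_coef (wt q).
Proof. by move=> p0 q0; case: (size_lead_wtM p0 q0). Qed.

Lemma cmul_neq0 p q : p != 0 -> q != 0 -> cmul p q != 0.
Proof.
move=> p0 q0; rewrite -wt_eq0 -lead_coef_eq0 lead_wtM //.
by rewrite mulf_neq0 // lead_coef_eq0 wt_eq0.
Qed.

Lemma conj_eq0 p : (cconj p == 0) = (p == 0).
Proof. by rewrite -wt_eq0 -size_poly_eq0 size_wt_conj size_poly_eq0 wt_eq0. Qed.

(** The norm is the product of p and its conjugate, which have equal pole orders, and v has a pole
    of order 2: the degree of the norm in v is the pole order of p. *)
Lemma size_nrm p : p != 0 -> size (nrm p) = size (wt p).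
Proof.
move=> p0; have := size_wtM p0 (_ : cconj p != 0); rewrite conj_eq0 => /(_ p0).
rewrite cmul_conj size_wt_conj /wt /= comp_poly0 mulr0 addr0 => sz.
have := size_comp_poly (nrm p) 'X^2; rewrite sz size_polyXn /= => sz2.
have swt0 : (0 < size (wt p))%N by rewrite size_poly_gt0 wt_eq0.
have np0 : nrm p != 0.
  by apply/eqP => n0; move: sz; rewrite n0 comp_poly0 size_poly0; move: swt0; case: (size _) => // k _; rewrite addnS.
have := size_poly_gt0 (nrm p); rewrite np0.
move: sz2 swt0; move: (size _) (size _) => b c; lia.
Qed.

Lemma nrm_neq0 p : p != 0 -> nrm p != 0.
Proof. by move=> p0; rewrite -size_poly_eq0 size_nrm // size_poly_eq0 wt_eq0. Qed.

End Functions.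

(** * Power series expansions at the point *)

(** [s] is the expansion of Y at a point P above v = 0 where Y does not vanish, so that v is a local
    parameter at P. *)
Record sqrt_at (K : fieldType) (f : {poly K}) (s : nat -> K) : Prop := SqrtAt {
  sqrt_sqr : forall m, \sum_(i < m.+1) s i * s (m - i)%N = f`_m;
  sqrt_neq0 : s 0 != 0;
  sqrt_char : 2%:R != 0 :> K;
  sqrt_monic : f \is monic;
  sqrt_size : size f = 6 }.

Section Expansion.

Variables (K : fieldType) (f : {poly K}) (s : nat -> K).

Implicit Types p q : cfun K.

Definition ser M : {poly K} := \poly_(i < M) s i.

(* The expansion of p, modulo v^M, at the point where Y is the series s(v). *)
Definition ev M p : {poly K} := p.1 + p.2 * ser M.

Definition vanish n p := 'X^n %| ev n p.

Lemma ev_is_linear M : linear (ev M).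
Proof.
by move=> c p q; rewrite /ev /= scalerDr mulrDl addrACA scalerAl.
Qed.

HB.instance Definition _ M :=
  GRing.isLinear.Build K (cfun K) {poly K} _ (ev M) (ev_is_linear M).

Lemma ev_conj M p : ev M (cconj p) = p.1 - p.2 * ser M.
Proof. by rewrite /ev /= mulNr. Qed.

Lemma ev_scal M c p : ev M (scal c p) = c * ev M p.
Proof. by rewrite /ev /= mulrDr mulrA. Qed.

Lemma ser_dvd n M : (n <= M)%N -> 'X^n %| ser M - ser n.
Proof.
move=> le_nM; apply/dvd_XnP => k ltkn.
by rewrite coefB !coef_poly ltkn (leq_trans ltkn le_nM) subrr.
Qed.

Lemma ev_dvd n M p : (n <= M)%N -> 'X^n %| ev M p - ev n p.
Proof.
move=> le_nM; rewrite [_ - _](_ : _ = p.2 * (ser M - ser n)); last by rewrite /ev; ring.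
by rewrite dvdp_mull // ser_dvd.
Qed.

Lemma coef_ev n M p k : (k < n)%N -> (n <= M)%N -> (ev M p)`_k = (ev n p)`_k.
Proof.
move=> ltkn le_nM; apply/eqP; rewrite -subr_eq0 -coefB.
by have /dvd_XnP-> := ev_dvd p le_nM.
Qed.

Lemma vanishE n M p : (n <= M)%N -> vanish n p = ('X^n %| ev M p).
Proof. by move=> le_nM; rewrite (dvdp_congr (ev_dvd p le_nM)). Qed.

Lemma vanish_le m n p : (m <= n)%N -> vanish n p -> vanish m p.
Proof.
by move=> le_mn; rewrite (vanishE p le_mn); apply: dvdp_trans; rewrite dvd_XnXn.
Qed.

Lemma vanish0 p : vanish 0 p.
Proof. by rewrite /vanish expr0 dvd1p. Qed.

Lemma vanish_scal n j p : vanish (n + j) (scal 'X^n p) = vanish j p.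
Proof.
by rewrite /vanish ev_scal exprD dvdp_mul2l ?Xn_neq0 // -vanishE ?leq_addl.
Qed.

Lemma wt_scal n p : wt (scal 'X^n p) = 'X^(n.*2) * wt p.
Proof.
by rewrite /wt /= !comp_polyM comp_Xn_poly -exprM mul2n; ring.
Qed.

Hypothesis fs : sqrt_at f s.

Lemma ser_sqr M : 'X^M %| ser M ^+ 2 - f.
Proof.
apply/dvd_XnP => k ltkM; rewrite coefB expr2 coefM -(sqrt_sqr fs).
apply/eqP; rewrite subr_eq0; apply/eqP/eq_bigr => i _.
have le_ik : (i <= k)%N by rewrite -ltnS.
by rewrite !coef_poly (leq_ltn_trans le_ik ltkM) (leq_ltn_trans (leq_subr i k) ltkM).
Qed.

Lemma ev_cmul M p q : 'X^M %| ev M (cmul f p q) - ev M p * ev M q.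
Proof.
rewrite [_ - _](_ : _ = (- (p.2 * q.2)) * (ser M ^+ 2 - f)); last by rewrite /ev /=; ring.
by rewrite dvdp_mull // ser_sqr.
Qed.

Lemma vanishM i j p q : vanish i p -> vanish j q -> vanish (i + j) (cmul f p q).
Proof.
rewrite (vanishE p (leq_addr j i)) (vanishE q (leq_addl i j)) => vp vq.
by rewrite /vanish (dvdp_congr (ev_cmul (i + j) p q)) exprD dvdp_mul.
Qed.

Lemma vanish_nrm n p : 'X^n %| ev n p * ev n (cconj p) - nrm f p.
Proof.
rewrite ev_conj [_ - _](_ : _ = (- (p.2 ^+ 2)) * (ser n ^+ 2 - f)).
  by rewrite dvdp_mull // ser_sqr.
by rewrite /ev /nrm; ring.
Qed.

Lemma coef0_ser M : (ser M.+1)`_0 = s 0.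
Proof. by rewrite coef_poly. Qed.

(** The sum and the difference of the expansions of a + bY and a - bY are 2a and 2bY. As 2 and the
    constant term of Y are units, v^n divides both a and b. *)
Lemma vanish_both n p : vanish n p -> vanish n (cconj p) ->
  exists q, p = scal 'X^n q.
Proof.
case: n => [|n]; first by exists p; rewrite /scal expr0 !mul1r -surjective_pairing.
rewrite /vanish ev_conj /ev => v1 v2.
have two0 : (2%:R%:P : {poly K})`_0 != 0 by rewrite coefC (sqrt_char fs).
have /dvdpP[a def_a] : 'X^(n.+1) %| p.1.
  rewrite -(dvd_XnMl _ _ two0).
  have := dvdp_add v1 v2; congr (_ %| _); ring.
have /dvdpP[b def_b] : 'X^(n.+1) %| p.2.
  have ser0 : (ser n.+1)`_0 != 0 by rewrite coef0_ser (sqrt_neq0 fs).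
  rewrite -(dvd_XnMl _ _ ser0) -(dvd_XnMl _ _ two0).
  have := dvdp_sub v1 v2; congr (_ %| _); ring.
by exists (a, b); rewrite /scal /= mulrC -def_a mulrC -def_b -surjective_pairing.
Qed.


(* The product of q and the conjugate of p vanishes to order i at both points *)
(* of the curve above v = 0, hence is divisible by v^i.                       *)
Lemma cofactor i j p q : (i <= j)%N -> p != 0 -> q != 0 ->
    vanish i p -> vanish j q ->
  exists k : cfun K, [/\ k != 0, vanish (j - i) k,
    nrm f p * nrm f q = 'X^(i.*2) * nrm f k
    & (size (wt k) + i.*2 = (size (wt p) + size (wt q)).-1)%N].
Proof.
move=> le_ij p0 q0 vp vq.
have v1 : vanish i (cmul f (cconj p) q).
  by apply: vanish_le (vanishM (vanish0 (cconj p)) vq).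
have v2 : vanish i (cconj (cmul f (cconj p) q)).
  rewrite conj_cmul conjK; apply: vanish_le (vanishM vp (vanish0 (cconj q))).
  by rewrite addn0.
have [k def_k] := vanish_both v1 v2.
have cp0 : cconj p != 0 by rewrite conj_eq0.
have := cmul_neq0 (sqrt_monic fs) (sqrt_size fs) cp0 q0; rewrite def_k => Xk0.
have k0 : k != 0.
  by apply: contraNneq Xk0 => ->; rewrite -wt_eq0 wt_scal linear0 mulr0.
exists k; split=> //.
- by rewrite -(vanish_scal i) subnKC // -def_k; apply: (vanishM (vanish0 (cconj p)) vq).
- by rewrite -(nrm_conj f p) -nrmM def_k nrm_scal -exprM muln2.
- have := size_wtM (sqrt_monic fs) (sqrt_size fs) cp0 q0.
  rewrite def_k wt_scal size_wt_conj size_mul ?Xn_neq0 ?wt_eq0 // size_polyXn.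
  by rewrite addSn /= addnC.
Qed.

(** The divisor of p is m (P - infinity): a norm proportional to v^m leaves zeros only above v = 0,
    and all m of them lie at P. *)
Definition generates m p := exists2 c : K, c != 0 & nrm f p = c *: 'X^m /\ vanish m p.

(** Modulo v^(m+1) the expansions of p and of its conjugate multiply to c v^m, and p already
    contributes v^m. *)
Lemma generates_unit m p : generates m p -> (ev 1 (cconj p))`_0 != 0.
Proof.
move=> [c c0 [nrm_p vp]].
have := vanish_nrm m.+1 p; move: vp; rewrite (vanishE p (leqnSn m)) => /dvdpP[r ->].
rewrite nrm_p mulrAC -mul_polyC -mulrBl exprS dvdp_mul2r ?Xn_neq0 // -['X]expr1.
move=> /dvd_XnP/(_ 0 isT); rewrite coefB coefC /= coefM big_ord1 /= => /eqP.
rewrite subr_eq0 (coef_ev _ (n := 1)) // => /eqP eq_c.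
by apply: contraNneq c0 => ev0; rewrite -eq_c ev0 mulr0.
Qed.

(** All zeros of p lie at P and its conjugate point. Dividing by v as long as both are zeros leaves
    a function with zeros at P only; e counts the divisions. There remain m > 0 zeros because N < 2j
    puts more than half of them at P. *)
Lemma extract_generator N j p c : c != 0 -> nrm f p = c *: 'X^N ->
    vanish j p -> (N < j.*2)%N ->
  exists m e q, [/\ (0 < m)%N, N = (m + e.*2)%N, (j <= m + e)%N & generates m q].
Proof.
move=> c0; elim/ltn_ind: N j p => N IHN j p nrm_p vp ltNj.
have j_gt0 : (0 < j)%N by lia.
have v1 : vanish 1 p by apply: vanish_le vp.
have [/dvd_XnP/(_ 0 isT) cv|ncv] := boolP (vanish 1 (cconj p)).
  have [|q def_p] := vanish_both v1; first by apply/dvd_XnP => -[|//] _.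
  have := nrm_p; rewrite def_p nrm_scal -exprM => nrmX.
  have le2N : (2 <= N)%N.
    by rewrite -(dvd_XnXn K) -(dvdpZr _ _ c0) -nrmX dvdp_mulr.
  have nrm_q : nrm f q = c *: 'X^(N - 2).
    apply: (mulfI (Xn_neq0 K 2)); rewrite nrmX -scalerAr -exprD.
    by rewrite subnKC.
  have vq : vanish j.-1 q.
    by rewrite -(vanish_scal 1) -def_p add1n prednK.
  have [||m [e [r [m0 eN lej gr]]]] := IHN (N - 2)%N _ _ _ nrm_q vq; [lia..|].
  by exists m, e.+1, r; split=> //; lia.
have cp0 : (ev 1 (cconj p))`_0 != 0.
  by apply: contraNneq ncv => ev0; apply/dvd_XnP => -[|//].
exists N, 0%N, p.
have gN : vanish N p.
  rewrite (vanishE p (leqnSn N)).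
  have cpN : (ev N.+1 (cconj p))`_0 != 0 by rewrite (coef_ev _ (n := 1)).
  rewrite -(dvd_XnMl _ _ cpN) mulrC.
  have := vanish_nrm N.+1 p; rewrite exprS => /(dvdp_trans (dvdp_mull 'X (dvdpp 'X^N))).
  by move=> /dvdp_congr->; rewrite nrm_p dvdpZr.
split; rewrite ?addn0 //; last by exists c.
  rewrite lt0n; apply/eqP => N0.
  have /dvd_XnP/(_ 0 isT) := vanish_nrm 1 p.
  have /dvd_XnP/(_ 0 isT) := v1.
  rewrite coefB coefM big_ord1 /= => ->; rewrite mul0r add0r nrm_p N0 => /eqP.
  by rewrite oppr_eq0 coefZ coefXn mulr1 (negPf c0).
rewrite leqNgt; apply/negP => ltNj'.
have : 'X^(N.+1) %| ev N.+1 p * ev N.+1 (cconj p).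
  by rewrite dvdp_mulr // -[_ %| _]/(vanish N.+1 p); apply: vanish_le vp.
by rewrite (dvdp_congr (vanish_nrm _ _)) nrm_p dvdpZr // dvd_XnXn ltnn.
Qed.

End Expansion.

(** * Jet determinants *)

Section Basis.

Variable K : fieldType.
Implicit Types p q : cfun K.

(* The pole orders 0, 2, 4, 5, 6, ... of v^i and v^i Y, in increasing order. *)
Definition pord (j : nat) : nat := if (j < 3)%N then j.*2 else j.+2.

Definition bas (j : nat) : cfun K :=
  if odd (pord j) then (0, 'X^((pord j - 5)./2)) else ('X^((pord j)./2), 0).

Lemma pord_lt i j : (i < j)%N -> (pord i < pord j)%N.
Proof.
by rewrite /pord => ltij; case: (ltnP i 3) => ?; case: (ltnP j 3) => ?; lia.
Qed.

Lemma wt_bas j : wt (bas j) = 'X^(pord j).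
Proof.
rewrite /bas; have [odd_j|even_j] := boolP (odd (pord j)); rewrite /wt /=.
  rewrite comp_poly0 add0r comp_Xn_poly -exprM -exprD; congr ('X^_).
  by move: odd_j; rewrite /pord; case: ltnP => [_|le3j]; [rewrite odd_double|lia].
rewrite comp_poly0 mulr0 addr0 comp_Xn_poly -exprM; congr ('X^_).
by move: even_j; lia.
Qed.

(** The only such d are 1 and 3, the Weierstrass gaps at infinity. *)
Lemma coef_wt_gap p d n : (pord n < d < pord n.+1)%N -> (wt p)`_d = 0.
Proof.
rewrite /pord coef_wt; case: n => [|[|[|n]]] /=; last by lia.
- by case: d => [|[|]].
- by case: d => [|[|[|[|]]]].
- by case: d => [|[|[|[|[|]]]]].
Qed.

Lemma bas_expand n p : (size (wt p) <= pord n)%N ->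
  p = \sum_(j < n) (wt p)`_(pord j) *: bas j.
Proof.
elim: n p => [|n IHn] p sz_p.
  by rewrite big_ord0; apply/eqP; rewrite -wt_eq0 -size_poly_eq0 -leqn0.
pose q := p - (wt p)`_(pord n) *: bas n.
have wt_q d : (wt q)`_d = (wt p)`_d - (wt p)`_(pord n) * (d == pord n)%:R.
  by rewrite /q raddfB /= linearZ /= wt_bas coefB coefZ coefXn.
rewrite big_ord_recr /= -[LHS](subrK ((wt p)`_(pord n) *: bas n)); congr (_ + _).
rewrite -/q [LHS]IHn.
  apply: eq_bigr => j _; congr (_ *: _); rewrite wt_q.
  by rewrite (ltn_eqF (pord_lt (ltn_ord j))) mulr0 subr0.
apply/leq_sizeP => d; rewrite leq_eqVlt => /orP[/eqP <-|ltnd].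
  by rewrite wt_q eqxx mulr1 subrr.
rewrite wt_q (gtn_eqF ltnd) mulr0 subr0; have [ltd|led] := ltnP d (pord n.+1).
  by rewrite (@coef_wt_gap _ _ n) // ltnd.
by rewrite nth_default // (leq_trans sz_p).
Qed.

Lemma coef_wt_sum n (a : 'I_n -> K) (i : 'I_n) :
  (wt (\sum_(j < n) a j *: bas j))`_(pord i) = a i.
Proof.
rewrite linear_sum coef_sum (bigD1 i) //= big1 => [|j neji].
  by rewrite addr0 linearZ /= wt_bas coefZ coefXn eqxx mulr1.
rewrite linearZ /= wt_bas coefZ coefXn.
have [lt|lt|eqij] := ltngtP i j; last by case/eqP: neji; apply/val_inj.
  by rewrite (ltn_eqF (pord_lt lt)) mulr0.
by rewrite (gtn_eqF (pord_lt lt)) mulr0.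
Qed.

Section Jets.

Variables (f : {poly K}) (s : nat -> K).

Definition jets n (phi : nat -> cfun K) : 'M[K]_n :=
  \matrix_(i < n, k < n) (ev s n (phi i))`_k.

Definition tdet n : K := \det (jets n bas).

(** A vector in the left kernel of the jet matrix lists the coordinates in [bas] of a function whose
    n-jet at P is zero. The bound on the size says that the pole order is less than [pord n], which
    is the span of the first n basis functions. *)
Lemma tdet_eq0P n :
  reflect (exists p, [/\ p != 0, (size (wt p) <= pord n)%N & vanish s n p])
          (tdet n == 0).
Proof.
have evsum (a : 'rV[K]_n) k :
    (ev s n (\sum_(j < n) a 0 j *: bas j))`_(val k) = (a *m jets n bas) 0 k.
  rewrite linear_sum coef_sum mxE; apply: eq_bigr => j _.
  by rewrite linearZ /= coefZ mxE.
apply: (iffP det0P) => [[a a0 aT]|[p [p0 sz_p vp]]].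
  exists (\sum_(j < n) a 0 j *: bas j); split.
  - apply: contraNneq a0 => p0; apply/eqP/rowP => i; rewrite mxE.
    by rewrite -(coef_wt_sum (fun j => a 0 j)) p0 linear0 coef0.
  - rewrite linear_sum; apply: (leq_trans (size_sum _ _ _)).
    apply/bigmax_leqP => j _; rewrite linearZ /= wt_bas.
    by rewrite (leq_trans (size_scale_leq _ _)) // size_polyXn pord_lt.
  - by apply/dvd_XnP => k ltkn; rewrite (evsum a (Ordinal ltkn)) aT mxE.
exists (\row_j (wt p)`_(pord j)).
  apply: contraNneq p0 => a0; rewrite (bas_expand sz_p) big1 // => j _.
  by move/rowP/(_ j): a0; rewrite !mxE => ->; rewrite scale0r.
apply/rowP => k; rewrite -evsum mxE.
under eq_bigr do rewrite mxE.
rewrite -bas_expand //; have /dvd_XnP-> := vp; last exact: ltn_ord.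
by [].
Qed.

(** Monic functions with the pole orders of [bas] arise from [bas] by a unitriangular change of
    basis. *)
Lemma det_jets_unitriangular n phi :
    (forall i, (i < n)%N -> size (wt (phi i)) = (pord i).+1) ->
    (forall i, (i < n)%N -> lead_coef (wt (phi i)) = 1) ->
  \det (jets n phi) = tdet n.
Proof.
move=> sz_phi lead_phi.
pose C := \matrix_(i < n, j < n) (wt (phi i))`_(pord j).
have -> : jets n phi = C *m jets n bas.
  apply/matrixP => i k; rewrite !mxE.
  rewrite [in LHS](@bas_expand n (phi i)) ?sz_phi ?pord_lt //.
  by rewrite linear_sum coef_sum; apply: eq_bigr => j _; rewrite linearZ /= coefZ !mxE.
rewrite det_mulmx det_trig ?big1 ?mul1r // => [i _|].
  by rewrite mxE -(lead_phi i) // lead_coefE sz_phi.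
apply/is_trig_mxP => i j ltij; rewrite mxE nth_default // sz_phi //.
exact: pord_lt.
Qed.

Hypothesis fs : sqrt_at f s.

Lemma generates_neq0 m p : generates f s m p -> p != 0.
Proof.
move=> [c c0 [nrm_p _]]; apply: contraTneq (Xn_neq0 K m) => p0.
have : c *: 'X^m == 0 :> {poly K} by rewrite -nrm_p p0 /nrm /= expr0n /= mul0r subrr.
by rewrite scaler_eq0 (negPf c0) negbK.
Qed.

Lemma generates_size m p : generates f s m p -> size (wt p) = m.+1.
Proof.
move=> gp; have p0 := generates_neq0 gp; case: gp => c c0 [nrm_p _].
by rewrite -(size_nrm (sqrt_monic fs) (sqrt_size fs) p0) nrm_p size_scale // size_polyXn.
Qed.

Lemma tdet_generates m n p : generates f s m p -> (m < pord n)%N -> (n <= m)%N ->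
  tdet n = 0.
Proof.
move=> gp ltm lenm; apply/eqP/tdet_eq0P; exists p; split.
- exact: generates_neq0 gp.
- by rewrite (generates_size gp).
- by case: gp => c _ [_]; apply: vanish_le.
Qed.

(** The function v p vanishes to order m + 1 at P, and its pole order m + 2 is still below
    [pord m.+1]. *)
Lemma tdet_generatesS m p : generates f s m p -> (0 < m)%N -> tdet m.+1 = 0.
Proof.
move=> gp m0; apply/eqP/tdet_eq0P; exists (scal 'X^1 p); split.
- rewrite -wt_eq0 wt_scal mulf_neq0 ?Xn_neq0 // wt_eq0.
  exact: generates_neq0 gp.
- rewrite wt_scal size_mul ?Xn_neq0 ?wt_eq0 ?(generates_neq0 gp) //.
  rewrite size_polyXn (generates_size gp).
  by case: (m) m0 => [|[|[|k]]].
- by case: gp => c _ [_ vp]; rewrite -add1n vanish_scal.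
Qed.

(** A pole of order at most 4 excludes Y and leaves a polynomial in v of degree at most 2, of which
    a double zero at P keeps only b v^2. A pole of order at most 3 excludes that term as well. *)
Lemma poly_small_weight k (n : nat) : (n < 3)%N -> (size (wt k) <= 3 + n)%N -> vanish s 2 k ->
  exists2 b : K, k = (b *: 'X^2, 0) & (n < 2)%N -> b = 0.
Proof.
move=> lt3 sz vk.
have k2 : k.2 = 0.
  apply/eqP; rewrite -size_poly_eq0 -leqn0; apply: size_snd.
  by rewrite (leq_trans sz) //; lia.
have szk1 : (size k.1 <= 3)%N by apply: size_fst; rewrite (leq_trans sz) //; lia.
have dvd1 : 'X^2 %| k.1 by move: vk; rewrite /vanish /ev k2 mul0r addr0.
exists k.1`_2 => [|lt2].
  rewrite [LHS]surjective_pairing k2; congr pair; apply/polyP => -[|[|[|i]]];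
    rewrite coefZ coefXn ?mulr0 ?mulr1 //=; try by move/dvd_XnP: dvd1; apply.
  by rewrite nth_default // (leq_trans szk1).
by rewrite coef_fst nth_default // (leq_trans sz) //; lia.
Qed.

Lemma nrm_dvd_Xn p q c N : p != 0 -> q != 0 -> nrm f p * nrm f q = c *: 'X^N -> c != 0 ->
  exists (c1 : K) e, [/\ c1 != 0, nrm f p = c1 *: 'X^e, size (wt p) = e.+1
    & (size (wt p) + size (wt q) = N.+2)%N].
Proof.
move=> p0 q0 pq c0.
have : nrm f p %| 'X^N by rewrite -(dvdpZr _ _ c0) -pq dvdp_mulr.
rewrite -['X]subr0 => /dvdp_exp_XsubCP[e _]; rewrite subr0 => /eqp_eq.
rewrite lead_coefXn scale1r => nrm_p.
have lc0 : lead_coef (nrm f p) != 0 by rewrite lead_coef_eq0 (nrm_neq0 (sqrt_monic fs) (sqrt_size fs)).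
exists (lead_coef (nrm f p)), e; split=> //.
  by rewrite -(size_nrm (sqrt_monic fs) (sqrt_size fs) p0) nrm_p size_scale // size_polyXn.
rewrite -(size_nrm (sqrt_monic fs) (sqrt_size fs) p0) -(size_nrm (sqrt_monic fs) (sqrt_size fs) q0).
have : size (nrm f p * nrm f q) = N.+1 by rewrite pq size_scale // size_polyXn.
have := size_poly_gt0 (nrm f p); have := size_poly_gt0 (nrm f q).
rewrite size_mul ?(nrm_neq0 (sqrt_monic fs) (sqrt_size fs)) //; move: (size _) (size _) => a b; lia.
Qed.

(* The cofactor of the functions p and q that vanish to order n - 1 and n + 1 *)
(* is small enough to be a multiple of v^2, so the norms of p and q are       *)
(* powers of v.                                                               *)
Lemma generates_of_tdet n : (3 < n)%N ->
  tdet n.-1 = 0 -> tdet n = 0 -> tdet n.+1 = 0 -> exists p, generates f s n p.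
Proof.
case: n => [//|[//|[//|[//|n]]]] _ /=.
move=> /eqP/tdet_eq0P[p [p0 szp vp]] /eqP/tdet_eq0P[r [r0 szr vr]].
move=> /eqP/tdet_eq0P[q [q0 szq vq]].
rewrite /pord /= in szp szq szr.
have le_n : (n.+3 <= n.+4.+1)%N by exact: leqW (leqW (leqnn _)).
have [k [k0 vk nrm_pq szk]] := cofactor fs le_n p0 q0 vp vq.
have [|||b def_k _] := @poly_small_weight k 2; rewrite ?subSn //.
- move: szk szp szq {vk nrm_pq}.
  by move: (size _) (size _) (size _) => A B C; clear; lia.
- by move: vk; rewrite !subSS subSn // subSnn.
have b0 : b != 0 by apply: contraNneq k0 => b0; rewrite def_k b0 scale0r.
have pqE : nrm f p * nrm f q = b ^+ 2 *: 'X^(n.+4.*2.+2).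
  rewrite nrm_pq def_k /nrm /= expr0n /= mul0r subr0 exprZn -exprM -scalerAr -exprD.
  by rewrite addnC.
have b20 : b ^+ 2 != 0 by rewrite expf_neq0.
have [c [e [c0 nrm_p sz_p sz_pq]]] := nrm_dvd_Xn p0 q0 pqE b20.
(* The bounds on the sizes of [p] and [q] add up to exactly the sum just found, so both are
   attained. *)
have en : e = n.+4.
  move: szp szq sz_p sz_pq {nrm_p vp szk}.
  by move: (size _) (size _) => A B; clear; lia.
rewrite en in nrm_p.
have [|m [e' [g [m0 nE le_n1 gg]]]] :=
  extract_generator fs c0 nrm_p vp.
  by clear; lia.
(* The case e' = 1 would give a generator whose index is two less. Its cofactor with [r] would have
   pole order at most 3 and a double zero at P, hence would be 0. *)
have [e0|e1] : e' = 0%N \/ e' = 1%N by move: nE le_n1; clear; lia.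
  by exists g; rewrite (_ : n.+4 = m) // nE e0 addn0.
have def_m : m = n.+2 by move: nE; rewrite e1; clear; lia.
rewrite {}def_m in gg; have g0 := generates_neq0 gg.
have vg : vanish s n.+2 g by case: gg => ? _ [].
have le_n' : (n.+2 <= n.+4)%N by exact: leqW (leqW (leqnn _)).
have [h [h0 vh _ szh]] := cofactor fs le_n' g0 r0 vg vr.
have [|||d def_h d0] := @poly_small_weight h 1; rewrite ?subSn //.
- move: szh szr (generates_size gg) {vh vg}.
  by move: (size _) (size _) (size _) => A B C; clear; lia.
- by move: vh; rewrite !subSS subSn // subSnn.
by case/eqP: h0; rewrite def_h d0 // scale0r.
Qed.

End Jets.
End Basis.

(** * Hankel determinants *)

Section RowReversal.

Variable R : comNzRingType.

Lemma expand_det_unit_row n (A : 'M[R]_n.+1) i0 j0 :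
    (forall j, A i0 j = (j == j0)%:R) ->
  \det A = (-1) ^+ (i0 + j0) * \det (row' i0 (col' j0 A)).
Proof.
move=> rowA; rewrite (expand_det_row _ i0) (bigD1 j0) //= rowA eqxx mul1r big1 ?addr0 //.
by move=> j /negPf nej; rewrite rowA nej mul0r.
Qed.

Lemma det_row_rev n (A : 'M[R]_n) :
  \det (\matrix_(i, j) A (rev_ord i) j) = (-1) ^+ 'C(n, 2) * \det A.
Proof.
pose rev_mx n : 'M[R]_n := \matrix_(i, j) (j == rev_ord i)%:R.
have -> : \matrix_(i, j) A (rev_ord i) j = rev_mx n *m A.
  apply/matrixP => i j; rewrite !mxE (bigD1 (rev_ord i)) //= mxE eqxx mul1r big1 ?addr0 //.
  by move=> k /negPf nek; rewrite mxE nek mul0r.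
rewrite det_mulmx; congr (_ * _); elim: n {A} => [|n IHn]; first by rewrite det_mx00.
rewrite (@expand_det_unit_row _ _ ord0 ord_max) => [|j]; last first.
  by rewrite mxE -!val_eqE /= subn1.
rewrite [(_ + _)%N]add0n binS bin1 [('C(n, 2) + n)%N]addnC exprD -IHn.
congr (_ * \det _).
apply/matrixP => i j; rewrite !mxE -!val_eqE /= /bump leq0n add1n subSS.
by rewrite leqNgt (ltn_ord j).
Qed.

End RowReversal.

Section Hankel.

Variables (K : fieldType) (s : nat -> K).

(** The coefficient of v^a in the expansion of v^b Y. *)
Definition sg (a b : nat) : K := if (b <= a)%N then s (a - b) else 0.

(* Obtained from jets by deleting rows equal to unit vectors, and the columns *)
(* of their nonzero entries.                                                  *)
Definition mixed L j c : 'M[K]_L := \matrix_(i < L, k < L)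
  (if (i < j)%N then sg (3 + c + k) i
   else if odd (i - j) then sg (3 + c + k) (j + (i - j)./2)
   else (k == (i - j)./2 :> nat)%:R).

(** Row j is the first unit vector. Expanding along it drops the first column, which raises c, and
    the next row, that of a multiple of Y, joins the first j. *)
Lemma det_mixedS L j c : (j <= L)%N ->
  \det (mixed L.+1 j c) = (-1) ^+ j * \det (mixed L j.+1 c.+1).
Proof.
move=> lejL; rewrite -ltnS in lejL; pose i0 := Ordinal lejL.
rewrite (@expand_det_unit_row _ _ _ i0 ord0) => [|k].
  rewrite addn0; congr (_ * _); congr determinant.
  apply/matrixP => a b; rewrite !mxE /= /bump leq0n add1n.
  rewrite (_ : 3 + c + b.+1 = 3 + c.+1 + b)%N; last by lia.
  have [lt|lt|->] := ltngtP a j.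
  - by rewrite add0n lt ltnS ltnW.
  - rewrite add1n ltnNge (leqW (ltnW lt)) /= ltnS leqNgt lt /=.
    rewrite (_ : a.+1 - j = (a - j.+1).+2)%N; last by lia.
    by rewrite /= negbK [(j.+1 + _)%N]addSnnS eqSS.
  - by rewrite [(_ + _)%N]add1n ltnNge leqnSn /= subSnn /= addn0 ltnSn.
by rewrite mxE /= ltnn subnn -val_eqE.
Qed.

Lemma det_mixed L j c q : (j + q <= L.+1)%N ->
  \det (mixed (L + q) j c) = (-1) ^+ (\sum_(i < q) (j + i)) * \det (mixed L (j + q) (c + q)).
Proof.
elim: q j c => [|q IHq] j c lejq; first by rewrite !addn0 big_ord0 mul1r.
rewrite addnS det_mixedS; last by lia.
rewrite IHq; last by lia.
rewrite big_ord_recl /= addn0 exprD -mulrA !addSnnS; congr (_ * (_ ^+ _ * _)).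
by apply: eq_bigr => i _; rewrite addSnnS.
Qed.

(** Once no unit rows remain, the matrix is Toeplitz up to the order of its rows; listing the rows
    backwards will give a Hankel matrix. *)
Lemma det_mixed_toeplitz N j c : (N <= j)%N ->
  \det (mixed N j c) = (-1) ^+ 'C(N, 2) * \det (\matrix_(i < N, k < N) sg (3 + c + k) (N - i.+1)).
Proof.
move=> leNj; rewrite -det_row_rev; congr determinant; apply/matrixP => i k; rewrite !mxE /=.
rewrite (leq_trans (ltn_ord i)) //; congr (sg _ _); have := ltn_ord i; lia.
Qed.

Lemma coef_ev_bas n i k : (k < n)%N -> (ev s n (bas K i))`_k =
  if odd (pord i) then sg k (pord i - 5)./2 else (k == (pord i)./2)%:R.
Proof.
move=> ltkn; rewrite /ev /bas; case: ifP => _ /=; last by rewrite mul0r addr0 coefXn.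
rewrite add0r coefXnM /sg ltnNge; case: leqP => //= le; rewrite coef_poly.
by rewrite (leq_ltn_trans (leq_subr _ _) ltkn).
Qed.

Lemma tdet2 : tdet s 2 = 1.
Proof.
rewrite /tdet (_ : jets _ _ _ = 1%:M) ?det1 //.
by apply/matrixP => -[[|[|//]] ?] [[|[|//]] ?]; rewrite !mxE coef_ev_bas.
Qed.

Lemma tdet_mixed L : tdet s (3 + L) = \det (mixed L 1 0).
Proof.
rewrite /tdet -[jets _ _ _]submxK.
have -> : ulsubmx (jets s (3 + L) (bas K)) = 1%:M.
  by apply/matrixP => -[[|[|[|//]]] ?] [[|[|[|//]]] ?]; rewrite !mxE coef_ev_bas.
have -> : ursubmx (jets s (3 + L) (bas K)) = 0.
  by apply/matrixP => -[[|[|[|//]]] ?] k; rewrite !mxE coef_ev_bas.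
rewrite det_lblock det1 mul1r; congr determinant; apply/matrixP => i k.
rewrite !mxE coef_ev_bas /=; last by rewrite ltn_add2l.
rewrite /pord ltnNge leq_addr /= addn0.
case: (i : nat) => [|i'] //=.
rewrite subn1 /= !negbK; case: ifP => odd_i.
  by congr (sg _ _); lia.
by congr (_%:R); rewrite -[in LHS](eqn_add2l 0); lia.
Qed.

Lemma sum_shift_double N : (\sum_(i < N) (1 + i) + 'C(N, 2) = N ^ 2)%N.
Proof.
elim: N => [|N IHN]; first by rewrite big_ord0.
rewrite big_ord_recr binS bin1 /= -[in RHS]addn1 sqrnD -IHN.
by move: (\sum_(i < N) _)%N 'C(N, 2) => A B; lia.
Qed.

Lemma tdet_even N : tdet s (N.*2.+2) = \det (\matrix_(i < N, j < N) s (3 + i + j)).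
Proof.
case: N => [|N]; first by rewrite tdet2 det_mx00.
rewrite (_ : N.+1.*2.+2 = 3 + (N.+1 + N))%N; last by lia.
rewrite tdet_mixed det_mixed ?add1n // add0n det_mixed_toeplitz // mulrA -exprD.
rewrite binS bin1 addnA sum_shift_double -signr_odd (_ : odd (N ^ 2 + N) = false).
  rewrite expr0 mul1r; congr determinant; apply/matrixP => i k; rewrite !mxE /sg.
  have := ltn_ord i => lti; rewrite ifT; last by lia.
  by congr (s _); lia.
by rewrite oddD oddX /= addbb.
Qed.

Lemma tdet_odd N :
  tdet s (N.*2.+3) = (-1) ^+ N * \det (\matrix_(i < N, j < N) s (4 + i + j)).
Proof.
rewrite (_ : N.*2.+3 = 3 + (N + N))%N; last by lia.
rewrite tdet_mixed det_mixed ?add1n // add0n det_mixed_toeplitz // mulrA -exprD.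
rewrite sum_shift_double -signr_odd oddX /= signr_odd; congr (_ * _).
congr determinant; apply/matrixP => i k; rewrite !mxE /sg.
have := ltn_ord i => lti; rewrite ifT; last by lia.
by congr (s _); lia.
Qed.

End Hankel.

(** * Translation by the order *)

Section Determinants.

Variable R : comNzRingType.

Lemma det_row_perm n (sigma : 'S_n) (A : 'M[R]_n) :
  \det (row_perm sigma A) = (-1) ^+ sigma * \det A.
Proof. by rewrite row_permE det_mulmx det_perm. Qed.

Lemma det_rev_tr n (A B : 'M[R]_n) :
  (forall i j, B i j = A (rev_ord j) (rev_ord i)) -> \det B = \det A.
Proof.
move=> eqB; pose sigma := perm (@rev_ord_inj n).
have -> : B = (row_perm sigma (col_perm sigma A))^T.
  by apply/matrixP => i j; rewrite !mxE !permE eqB.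
rewrite det_tr det_row_perm col_permE det_mulmx det_perm odd_permV.
by rewrite mulrCA -signr_addb addbb mulr1.
Qed.

(** Jacobi's identity on complementary minors. Replacing the lower rows of M U by those of the
    identity and multiplying by N gives a block lower triangular matrix with diagonal blocks those
    of L and N. *)
Lemma minor_duality n1 n2 (M U N L : 'M[R]_(n1 + n2)) :
    M *m U *m N = L -> dlsubmx U = 0 -> ursubmx L = 0 -> \det (ulsubmx L) = 1 ->
  \det (ulsubmx M) * \det (ulsubmx U) * \det N = \det (drsubmx N).
Proof.
move=> defL U0 L0 L1; set X := M *m U in defL.
have ulX : ulsubmx X = ulsubmx M *m ulsubmx U.
  by rewrite /X -[M]submxK -[U]submxK mulmx_block U0 !block_mxKul mulmx0 addr0.
have : block_mx (ulsubmx X) (ursubmx X) 0 1%:M *m N =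
       block_mx (ulsubmx L) 0 (dlsubmx N) (drsubmx N).
  rewrite -[N in LHS]submxK mulmx_block !mul0mx !mul1mx !add0r.
  have := defL; rewrite -{1}[X]submxK -{1}[N]submxK mulmx_block -[L in _ = L]submxK L0.
  by case/eq_block_mx => -> -> _ _.
move/(congr1 determinant); rewrite det_mulmx det_ublock det_lblock det1 mulr1 L1 mul1r.
by rewrite ulX det_mulmx.
Qed.

Definition toeplitz n (r : {poly R}) : 'M[R]_n :=
  \matrix_(i < n, j < n) (if (i <= j)%N then r`_(j - i) else 0).

Lemma det_toeplitz n r : \det (toeplitz n r) = r`_0 ^+ n.
Proof.
rewrite -det_tr det_trig.
  under eq_bigr => i _ do rewrite !mxE leqnn subnn.
  by rewrite prodr_const card_ord.
by apply/is_trig_mxP => i j ltij; rewrite !mxE leqNgt ltij.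
Qed.

Lemma mul_toeplitz n (P : 'I_n -> {poly R}) r :
  (\matrix_(i, j) (P i)`_j) *m toeplitz n r = \matrix_(i, j) (P i * r)`_j.
Proof.
apply/matrixP => i j; rewrite !mxE coefM.
rewrite (big_ord_widen_cond n xpredT (fun k => (P i)`_k * r`_(j - k)));
  last exact: ltn_ord.
rewrite [RHS]big_mkcond /=; apply: eq_bigr => k _; rewrite !mxE ltnS.
by case: ifP; rewrite ?mulr0.
Qed.

End Determinants.

(* windex m enumerates the m basis functions bas whose pole order is not of   *)
(* the form m + pord j.                                                       *)
Definition windex (m i : nat) : nat :=
  if (i < m - 2)%N then i else if i == (m - 2)%N then m.-1 else m.+1.

Lemma windex_lt m i j : (4 < m)%N -> (i < j < m)%N -> (windex m i < windex m j)%N.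
Proof.
move=> m_ge5 ltijm; rewrite /windex.
case: (ltnP i (m - 2)) => h1; case: (ltnP j (m - 2)) => h2; do ?case: eqP => ?; lia.
Qed.

(** The pole orders form the symmetric semigroup generated by 2 and 5, and those of the functions
    selected by [windex] are its Apéry set for m, which is invariant under d -> m + 3 - d. For such
    a pair p, q, the differential p q omega / g has a simple pole at infinity. *)
Lemma pord_windex_rev m i : (4 < m)%N -> (i < m)%N ->
  (pord (windex m i) + pord (windex m (m - i.+1)) = m.+3)%N.
Proof.
move=> m_ge5 ltim; rewrite /windex.
case: (ltnP i (m - 2)) => h1; last case: eqP => h2.
- case: (ltnP (m - i.+1) (m - 2)) => h3; last case: eqP => h4.
  + rewrite /pord; case: (ltnP i 3) => h5; case: (ltnP _ 3) => h6; lia.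
  + rewrite /pord; case: (ltnP i 3) => h5; case: (ltnP _ 3) => h6; lia.
  + rewrite /pord; case: (ltnP i 3) => h5; case: (ltnP _ 3) => h6; lia.
- rewrite (_ : m - i.+1 = 1)%N; last by lia.
  by rewrite ifT; [rewrite /pord ifF /=; lia|lia].
- rewrite (_ : m - i.+1 = 0)%N; last by lia.
  by rewrite ifT; [rewrite /pord ifF /=; lia|lia].
Qed.

Section Translation.

Variables (K : fieldType) (f : {poly K}) (s : nat -> K).
Hypothesis fs : sqrt_at f s.

Variables (m : nat) (g : cfun K).
Hypothesis m_ge5 : (4 < m)%N.
Hypothesis g_gen : generates f s m g.
Hypothesis g_monic : lead_coef (wt g) = 1.

Definition wfam (i : nat) : cfun K := bas K (windex m i).

Definition wdet : K := \det (jets s m wfam).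

Definition lead_exp : K := (ev s m.+1 g)`_m.

Lemma size_lead_shift j :
  size (wt (cmul f g (bas K j))) = (m + pord j).+1 /\
  lead_coef (wt (cmul f g (bas K j))) = 1.
Proof.
have g0 := generates_neq0 g_gen.
have b0 : bas K j != 0 by rewrite -wt_eq0 wt_bas Xn_neq0.
have [-> ->] := size_lead_wtM (sqrt_monic fs) (sqrt_size fs) g0 b0.
rewrite wt_bas size_polyXn (generates_size fs g_gen) g_monic lead_coefXn mulr1.
by rewrite addSn addnS.
Qed.

Definition shifted_fam (i : nat) : cfun K :=
  if (i < m)%N then wfam i else cmul f g (bas K (i - m)).

(** Multiples of g vanish to order m at P, so the jet matrix is block triangular. The second
    diagonal block is the n-jet matrix of [bas] times multiplication by the series g / v^m, whose
    constant term is [lead_exp]. *)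
Lemma det_jets_shifted n :
  \det (jets s (m + n) shifted_fam) = wdet * (lead_exp ^+ n * tdet s n).
Proof.
have [c _ [_ vg]] := g_gen.
rewrite -[jets _ _ _]submxK.
have -> : dlsubmx (jets s (m + n) shifted_fam) = 0.
  apply/matrixP => j k; rewrite !mxE /= /shifted_fam ltnNge leq_addr /= addKn.
  have : 'X^m %| ev s (m + n) (cmul f g (bas K j)).
    by rewrite -vanishE ?leq_addr // -[m]addn0 (vanishM fs) ?vanish0.
  by move/dvd_XnP->.
rewrite det_ublock; congr (_ * _).
  congr determinant; apply/matrixP => i k; rewrite !mxE /= /shifted_fam ltn_ord.
  by rewrite (coef_ev s _ (ltn_ord k)) // leq_addr.
have := vg; rewrite (vanishE s g (leq_addr n m)) => /dvdpP[r ev_g].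
have -> : drsubmx (jets s (m + n) shifted_fam) = jets s n (bas K) *m toeplitz n r.
  rewrite mul_toeplitz; apply/matrixP => j k.
  rewrite !mxE /= /shifted_fam ltnNge leq_addr /= addKn.
  have ltk : (m + k < m + n)%N by rewrite ltn_add2l.
  have /dvd_XnP/(_ _ ltk)/eqP := ev_cmul fs (m + n) g (bas K j).
  rewrite coefB subr_eq0 => /eqP->; rewrite ev_g mulrAC coefMXn ltnNge leq_addr /= addKn.
  rewrite mulrC !coefM; apply: eq_bigr => i _; rewrite (coef_ev s _ (n := n)) ?leq_addl //.
  exact: leq_ltn_trans (leq_ord i) (ltn_ord k).
rewrite det_mulmx mulrC det_toeplitz; congr (_ * _).
case: n ev_g {vg} => [|n] ev_g; first by rewrite !expr0.
congr (_ ^+ _); rewrite /lead_exp -(coef_ev s g (ltnSn m) (M := m + n.+1)).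
  by rewrite ev_g coefMXn ltnn subnn.
by rewrite addnS ltnS leq_addr.
Qed.

(** The pole orders of [shifted_fam] are those of [bas], except that at positions m - 2, ..., m + 1
    they come as m + 1, m + 3, m, m + 2. Sorting them is a 4-cycle, hence the sign; n >= 2 ensures
    that both g and v g occur. *)
Lemma tdet_shift n : (1 < n)%N ->
  tdet s (m + n) = - (wdet * (lead_exp ^+ n * tdet s n)).
Proof.
move=> n_ge2; rewrite -det_jets_shifted.
have lt0 : (m - 2 < m + n)%N by clear -m_ge5 n_ge2; lia.
have lt1 : (m.-1 < m + n)%N by clear -m_ge5 n_ge2; lia.
have lt2 : (m < m + n)%N by clear -m_ge5 n_ge2; lia.
have lt3 : (m.+1 < m + n)%N by clear -m_ge5 n_ge2; lia.
pose i0 := Ordinal lt0; pose i1 := Ordinal lt1.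
pose i2 := Ordinal lt2; pose i3 := Ordinal lt3.
pose sigma : 'S_(m + n) := (tperm i0 i2 * tperm i0 i3 * tperm i0 i1)%g.
(* phi lists the functions of shifted_fam by increasing pole order, which     *)
(* only moves the positions m - 2, ..., m + 1.                                *)
pose phi (i : nat) : cfun K :=
  if (i == m - 2)%N then cmul f g (bas K 0)
  else if i == m then cmul f g (bas K 1)
  else if (i < m.+2)%N then bas K i else cmul f g (bas K (i - m)).
have e02 : (m - 2 == m)%N = false by clear -m_ge5; lia.
have e12 : (m.-1 == m)%N = false by clear -m_ge5; lia.
have e10 : (m.-1 == m - 2)%N = false by clear -m_ge5; lia.
have e32 : (m.+1 == m)%N = false by clear -m_ge5; lia.
have e30 : (m.+1 == m - 2)%N = false by clear -m_ge5; lia.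
have e31 : (m.+1 == m.-1)%N = false by clear -m_ge5; lia.
have ne_ord (i j : 'I_(m + n)) : (val i == val j) = false -> (i != j) * (j != i).
  by move=> neij; rewrite (eq_sym j) -!val_eqE neij.
have [n10 n01] := ne_ord i1 i0 e10.
have [n02 n20] := ne_ord i0 i2 e02.
have [n30 n03] := ne_ord i3 i0 e30.
have [n12 n21] := ne_ord i1 i2 e12.
have [n31 n13] := ne_ord i3 i1 e31.
have [n32 n23] := ne_ord i3 i2 e32.
have odd_sigma : odd_perm sigma = true.
  by rewrite /sigma !odd_permM !odd_tperm n01 n02 n03.
have phiE : jets s (m + n) phi = row_perm sigma (jets s (m + n) shifted_fam).
  apply/matrixP => i k; rewrite !mxE; congr (polyseq (ev _ _ _))`_ _.
  rewrite /sigma !permM.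
  have [->|ne0] := eqVneq i i0.
    rewrite tpermL (tpermD n02 n32) (tpermD n02 n12).
    by rewrite /phi /shifted_fam /= eqxx ltnn subnn.
  have [->|ne2] := eqVneq i i2.
    rewrite tpermR tpermL (tpermD n03 n13).
    rewrite /phi /shifted_fam /= eqxx eq_sym e02.
    by rewrite ltnNge leqnSn /= subSnn.
  have [->|ne3] := eqVneq i i3.
    rewrite (tpermD n03 n23) tpermR tpermL /phi /shifted_fam /wfam /windex /=.
    rewrite e30 e32 ltnS leqnn e10 (_ : (m.-1 < m)%N); last by clear -m_ge5; lia.
    by rewrite ifN //; clear -m_ge5; lia.
  have [->|ne1] := eqVneq i i1.
    rewrite (tpermD n01 n21) (tpermD n01 n31) tpermR.
    rewrite /phi /shifted_fam /wfam /windex /= e10 e12 ltnn eqxx.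
    rewrite (_ : (m.-1 < m.+2)%N); last by clear -m_ge5; lia.
    by rewrite (_ : (m - 2 < m)%N) //; clear -m_ge5; lia.
  rewrite !tpermD // 1?eq_sym //.
  move: ne0 ne1 ne2 ne3; rewrite -!val_eqE /= => ne0 ne1 ne2 ne3.
  rewrite /phi /shifted_fam /wfam /windex (negPf ne0) (negPf ne2).
  have [ltim|leim] := ltnP i m.
    rewrite ifT; last by clear -ltim; lia.
    by rewrite ifT //; clear -ltim ne0 ne1; lia.
  by rewrite ifN //; clear -leim ne2 ne3; lia.
have <- : \det (jets s (m + n) phi) = tdet s (m + n).
  suff szl i : size (wt (phi i)) = (pord i).+1 /\ lead_coef (wt (phi i)) = 1.
    by apply: det_jets_unitriangular => i _; have [] := szl i.
  rewrite /phi; case: eqP => [->|ne0].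
    have [-> ->] := size_lead_shift 0; split=> //; rewrite /pord /=.
    by case: ltnP; clear -m_ge5; lia.
  case: eqP => [->|ne2].
    have [-> ->] := size_lead_shift 1; split=> //; rewrite /pord /=.
    by case: ltnP; clear -m_ge5; lia.
  case: ltnP => [lti|lei]; first by rewrite wt_bas size_polyXn lead_coefXn.
  have [-> ->] := size_lead_shift (i - m); split=> //; rewrite /pord.
  by case: ltnP => h1; case: ltnP => h2; clear -m_ge5 lei h1 h2; lia.
by rewrite phiE det_row_perm odd_sigma expr1 mulN1r.
Qed.

End Translation.

(** * Reflection *)

Section Residue.

Variables (K : fieldType) (f : {poly K}) (s : nat -> K).
Hypothesis fs : sqrt_at f s.

Variables (m : nat) (g : cfun K).
Hypothesis m_gt0 : (0 < m)%N.
Hypothesis g_gen : generates f s m g.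
Hypothesis g_monic : lead_coef (wt g) = 1.

Lemma wt_fst (a : {poly K}) : wt (a, 0) = a \Po 'X^2.
Proof. by rewrite /wt /= comp_poly0 mulr0 addr0. Qed.

(** A multiple of the conjugate of g. Since 1 / g = g' / v^m, it turns residues of p q omega / g
    into coefficients of p q g'. *)
Lemma cogenerator : exists g' : cfun K,
  [/\ cmul f g g' = ('X^m, 0), size (wt g') = m.+1, lead_coef (wt g') = 1
    & vanish s m (cconj g')].
Proof.
have g0 := generates_neq0 g_gen; have szg := generates_size fs g_gen.
have [c c0 [nrm_g vg]] := g_gen.
have gg' : cmul f g (c^-1 *: cconj g) = ('X^m, 0).
  rewrite linearZ /= cmul_conj nrm_g; congr pair => /=; last exact: scaler0.
  by rewrite scalerA mulVf // scale1r.
have sz' : size (wt (c^-1 *: cconj g)) = m.+1.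
  by rewrite linearZ /= size_scale ?invr_eq0 // size_wt_conj.
have g'0 : c^-1 *: cconj g != 0 by rewrite -wt_eq0 -size_poly_eq0 sz'.
exists (c^-1 *: cconj g); split=> //.
  have := lead_wtM (sqrt_monic fs) (sqrt_size fs) g0 g'0.
  by rewrite g_monic mul1r => <-; rewrite gg' wt_fst comp_Xn_poly -exprM lead_coefXn.
have -> : cconj (c^-1 *: cconj g) = c^-1 *: g.
  by case: (g) => a b; rewrite /cconj /= -scalerN opprK.
by rewrite /vanish linearZ /= dvdpZr ?invr_eq0.
Qed.

(* For the differential omega = dv / (2Y), the coefficient of v^(m-1) below   *)
(* is the residue at P of p q omega / g.  The only other possible pole is the *)
(* one at infinity, whose order is controlled by the weights of p and q.      *)
Lemma residue_pairing : exists theta : {poly K},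
  [/\ theta`_0 = (2%:R * s 0%N * lead_exp s m g)^-1,
      forall p q : cfun K, p != 0 -> q != 0 -> (size (wt p) + size (wt q) <= m.+4)%N ->
        (ev s m p * theta * ev s m q)`_m.-1 = 0
    & forall p q : cfun K, (size (wt p) + size (wt q) = m.+4.+1)%N ->
        lead_coef (wt p) = 1 -> lead_coef (wt q) = 1 ->
        (ev s m p * theta * ev s m q)`_m.-1 = 1].
Proof.
have g0 := generates_neq0 g_gen; have szg := generates_size fs g_gen.
have [g' [gg' sz' lead' vg']] := cogenerator.
have g'0 : g' != 0 by rewrite -wt_eq0 -size_poly_eq0 sz'.
have [inv invP] : exists inv : {poly K}, 'X^m %| inv * (2%:R *: ser s m) - 1.
  have /Bezout_coprimepP[[u v] /=] : coprimep (2%:R *: ser s m) 'X^m.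
    rewrite coprimep_expr // coprimepX /root horner_coef0 coefZ coef_poly m_gt0.
    by rewrite mulf_neq0 ?(sqrt_char fs) ?(sqrt_neq0 fs).
  rewrite -size_poly_eq1 => /size_poly1P[c c0 uv].
  exists (c^-1 *: u); rewrite -scalerAl [_ * _](_ : _ = c%:P - v * 'X^m); last first.
    by rewrite -uv addrK.
  rewrite scalerBr -[c^-1 *: c%:P]mul_polyC -polyCM mulVf // addrAC subrr add0r.
  by rewrite dvdpNr dvdpZr ?invr_eq0 // dvdp_mull.
(* For h = p q g' the coefficient of Y is (h - conj h) / 2Y, and conj h vanishes to order m at P:
   modulo v^m it is the expansion of h / 2Y. *)
have coef_snd_prod p q : (cmul f (cmul f p q) g').2`_m.-1 =
    (ev s m p * (inv * ev s m g') * ev s m q)`_m.-1.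
  set h := cmul f _ g'.
  have vh : vanish s m (cconj h).
    by rewrite /h conj_cmul -[m in vanish _ m _]add0n (vanishM fs (vanish0 _ _) vg').
  apply/eqP; rewrite -subr_eq0 -coefB.
  suff /dvd_XnP-> : 'X^m %| h.2 - ev s m p * (inv * ev s m g') * ev s m q.
  - by [].
  - by rewrite ltn_predL.
  have evh : 'X^m %| ev s m h - ev s m p * ev s m q * ev s m g'.
    have := ev_cmul fs m (cmul f p q) g'; rewrite -/h => /dvdp_add.
    move/(_ _ (dvdp_mulr (ev s m g') (ev_cmul fs m p q))).
    by congr (_ %| _); ring.
  have := dvdp_sub evh vh; rewrite ev_conj => /(dvdp_mull inv).
  move/(dvdp_sub)/(_ (dvdp_mull h.2 invP)).
  have -> : ev s m h = h.1 + h.2 * ser s m by [].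
  by congr (_ %| _); rewrite scaler_nat; ring.
exists (inv * ev s m g'); split.
- have inv0 : inv`_0 * (2%:R * s 0%N) = 1.
    have /dvd_XnP/(_ 0 m_gt0)/eqP := invP.
    by rewrite coefB coef1 subr_eq0 coef0M coefZ coef_poly m_gt0 => /eqP.
  have g'0E : lead_exp s m g * (ev s m g')`_0 = 1.
    have [c _ [_]] := g_gen; rewrite (vanishE s g (leqnSn m)) => /dvdpP[r ev_g].
    have /dvd_XnP/(_ m (ltnSn m))/eqP := ev_cmul fs m.+1 g g'.
    rewrite gg' coefB subr_eq0 /lead_exp {1}/ev /= mul0r addr0 coefXn eqxx ev_g.
    rewrite mulrAC !coefMXn ltnn subnn coef0M => /eqP eq1.
    by rewrite -(coef_ev s _ m_gt0 (leqnSn m)) -eq1.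
  rewrite coef0M; apply: (@mulIf _ (2%:R * s 0%N * lead_exp s m g)).
    rewrite !mulf_neq0 ?(sqrt_char fs) ?(sqrt_neq0 fs) //.
    by apply: contra_eq_neq g'0E => ->; rewrite mul0r eq_sym oner_neq0.
  rewrite mulVf.
    by rewrite mulrACA inv0 mul1r mulrC.
  rewrite !mulf_neq0 ?(sqrt_char fs) ?(sqrt_neq0 fs) //.
  by apply: contra_eq_neq g'0E => ->; rewrite mul0r eq_sym oner_neq0.
(* The coefficient of v^(m-1) Y in h is also that of T^(2m+3) in [wt h]. The pole order of h is here
   at most 2m + 2; in the next case it is exactly 2m + 3. *)
- move=> p q p0 q0 szpq; rewrite -coef_snd_prod coef_snd nth_default //.
  have pq0 := cmul_neq0 (sqrt_monic fs) (sqrt_size fs) p0 q0.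
  rewrite !(size_wtM (sqrt_monic fs) (sqrt_size fs)) // sz'.
  move: szpq m_gt0; move: (size _) (size _) => A B; clear; lia.
- move=> p q szpq lead_p lead_q; rewrite -coef_snd_prod coef_snd.
  have p0 : p != 0 by rewrite -wt_eq0 -lead_coef_eq0 lead_p oner_neq0.
  have q0 : q != 0 by rewrite -wt_eq0 -lead_coef_eq0 lead_q oner_neq0.
  have pq0 := cmul_neq0 (sqrt_monic fs) (sqrt_size fs) p0 q0.
  have := lead_wtM (sqrt_monic fs) (sqrt_size fs) pq0 g'0.
  rewrite (lead_wtM (sqrt_monic fs) (sqrt_size fs) p0 q0) lead_p lead_q lead' !mulr1 => <-.
  rewrite lead_coefE (size_wtM (sqrt_monic fs) (sqrt_size fs) pq0 g'0).
  rewrite (size_wtM (sqrt_monic fs) (sqrt_size fs) p0 q0) sz' szpq.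
  by congr (_`_ _); move: m_gt0; clear; lia.
Qed.

End Residue.

Lemma coefM_pred (R : nzRingType) (p q : {poly R}) m : (0 < m)%N ->
  (p * q)`_m.-1 = \sum_(k < m) p`_k * q`_(m - k.+1).
Proof. by case: m => // m _; rewrite coefM. Qed.

Section Reflection.

Variables (K : fieldType) (f : {poly K}) (s : nat -> K).
Hypothesis fs : sqrt_at f s.

Variables (n1 n2 : nat) (g : cfun K).
Let m := (n1 + n2)%N.
Hypotheses (n1_ge2 : (1 < n1)%N) (n2_ge2 : (1 < n2)%N) (m_ge5 : (4 < m)%N).
Hypothesis g_gen : generates f s m g.
Hypothesis g_monic : lead_coef (wt g) = 1.

(** By [pord_windex_rev], the residue pairing of [wfam] with itself in reverse order has a
    unitriangular Gram matrix M U N. Its determinant gives the first identity. Since the first m - 2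
    functions of [wfam] are those of [bas], its complementary minors of sizes n1 and n2 give the
    second. *)
Lemma reflection : exists theta0 : K,
  [/\ theta0 = (2%:R * s 0%N * lead_exp s m g)^-1,
      wdet s m * theta0 ^+ m * wdet s m = 1
    & tdet s n1 * theta0 ^+ n1 * wdet s m = tdet s n2].
Proof.
have m_gt0 : (0 < m)%N by apply: ltn_trans m_ge5.
have [theta [theta0 res0 res1]] := residue_pairing fs m_gt0 g_gen g_monic.
pose M := jets s m (wfam K m); pose U := toeplitz m theta.
pose N : 'M[K]_m := \matrix_(i, j) M (rev_ord j) (rev_ord i).
pose wo i := pord (windex m i).
have wt_w i : wt (wfam K m i) = 'X^(wo i) by rewrite /wfam wt_bas.
have w0 i : wfam K m i != 0 by rewrite -wt_eq0 wt_w Xn_neq0.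
have MUN i j : (M *m U *m N) i j =
    (ev s m (wfam K m i) * theta * ev s m (wfam K m (rev_ord j)))`_m.-1.
  rewrite /M /U mul_toeplitz (coefM_pred _ _ m_gt0) mxE; apply: eq_bigr => k _.
  by rewrite !mxE.
have lower (i j : 'I_m) : (i < j)%N -> (M *m U *m N) i j = 0.
  move=> ltij; rewrite MUN res0 // !wt_w !size_polyXn addSn addnS !ltnS.
  rewrite -ltnS -/m -(pord_windex_rev m_ge5 (ltn_ord j)) ltn_add2r pord_lt //.
  by rewrite windex_lt // ltij ltn_ord.
have diag i : (M *m U *m N) i i = 1.
  rewrite MUN res1 // ?wt_w ?lead_coefXn // !size_polyXn addSn addnS.
  by rewrite -/m -(pord_windex_rev m_ge5 (ltn_ord i)).
have detN : \det N = wdet s m by apply: det_rev_tr => i j; rewrite mxE.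
exists theta`_0; split=> //.
  rewrite -[X in X * _ * _]/(\det M) -[in X in _ * X]detN -det_toeplitz -!det_mulmx.
  rewrite det_trig; first by rewrite big1.
  by apply/is_trig_mxP => i j; apply: lower.
have U0 : dlsubmx U = 0.
  apply/matrixP => i j; rewrite !mxE leqNgt /=.
  by rewrite (leq_trans (ltn_ord j)) ?leq_addr.
have ursubE (A : 'M[K]_(n1 + n2)) i j : ursubmx A i j = A (lshift n2 i) (rshift n1 j).
  by rewrite !mxE.
have ulsubE (A : 'M[K]_(n1 + n2)) i j : ulsubmx A i j = A (lshift n2 i) (lshift n2 j).
  by rewrite !mxE.
have L0 : ursubmx (M *m U *m N) = 0.
  apply/matrixP => i j; rewrite [RHS]mxE ursubE lower //=.
  by rewrite (leq_trans (ltn_ord i)) ?leq_addr.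
have L1 : \det (ulsubmx (M *m U *m N)) = 1.
  rewrite det_trig; first by rewrite big1 // => i _; rewrite ulsubE; apply: diag.
  by apply/is_trig_mxP => i j ltij; rewrite ulsubE; apply: lower.
have := minor_duality erefl U0 L0 L1.
have w_small i : (i < m - 2)%N -> wfam K m i = bas K i by rewrite /wfam /windex => ->.
have -> : ulsubmx M = jets s n1 (bas K).
  apply/matrixP => i j; rewrite !mxE /= w_small.
    by rewrite (coef_ev s _ (ltn_ord j)) ?leq_addr.
  by have := ltn_ord i; rewrite /m; move: n2_ge2 (i : nat); clear; lia.
have -> : ulsubmx U = toeplitz n1 theta by apply/matrixP => i j; rewrite !mxE.
have -> : \det (drsubmx N) = tdet s n2.
  apply: det_rev_tr => i j; rewrite !mxE /= -!addnS /m !subnDl -/m.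
  have n2_gt0 : (0 < n2)%N by apply: ltn_trans n2_ge2.
  have lt_rev k : (n2 - k.+1 < n2)%N by rewrite ltn_subrL n2_gt0.
  rewrite w_small; last by move: (lt_rev j); rewrite /m; move: n1_ge2; clear; lia.
  by rewrite (coef_ev s _ (lt_rev i)) ?leq_addl.
by rewrite det_toeplitz detN.
Qed.

End Reflection.

(** * Cantor polynomials as jet determinants *)

Lemma det_scale_rank1 (R : comNzRingType) n (c : R) (r : 'I_n -> R) (A B : 'M[R]_n) :
  (forall i j, B i j = c * (r i * r j) * A i j) ->
  \det B = c ^+ n * (\prod_i r i) ^+ 2 * \det A.
Proof.
move=> eqB; pose D := diag_mx (\row_i r i).
have -> : B = c *: (D *m A *m D).
  by apply/matrixP => i j; rewrite /D mul_diag_mx mul_mx_diag !mxE eqB; ring.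
rewrite detZ !det_mulmx det_diag; under eq_bigr do rewrite mxE.
ring.
Qed.

Lemma coef_comp_opp (R : comNzRingType) (p : {poly R}) m :
  (p \Po - 'X)`_m = (-1) ^+ m * p`_m.
Proof.
have -> : p \Po - 'X = \poly_(i < size p) ((-1) ^+ i * p`_i).
  rewrite comp_polyE poly_def; apply: eq_bigr => i _.
  have -> : (- 'X) ^+ i = ((-1) ^+ i)%:P * 'X^i :> {poly R}.
    by rewrite polyC_exp polyCN -exprNn.
  by rewrite mul_polyC scalerA mulrC.
by rewrite coef_poly; case: ltnP => // lem; rewrite nth_default // mulr0.
Qed.

Section CantorDeterminants.

Variables (a : 'I_5 -> int) (L : fieldType) (xP yP : int).
Hypothesis P_on_C : yP ^+ 2 = (quintic a).[xP].
Hypothesis u_neq0 : 2%:R * yP%:~R != 0 :> L.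

Definition value_at : {rmorphism {poly int} -> L} := intr \o horner_eval xP.

Definition local_poly : {poly L} := curve_poly a L \Po ('X + xP%:~R%:P).

(* Cantor expands the root of F(X - z) with constant term -Y: the sign turns  *)
(* z into X - x and the constant term into Y.                                 *)
Definition root_series (j : nat) : L :=
  (-1) ^+ j.+1 * sqrt_series value_at yP%:~R (cantorP (quintic a)) j.

Let F := quintic a.
Let u : L := 2%:R * yP%:~R.

Lemma value_at_F : yP%:~R ^+ 2 = value_at F.
Proof. by rewrite /value_at /= /horner_eval -P_on_C rmorphXn. Qed.

Lemma coef_local_poly m : local_poly`_m = (-1) ^+ m * value_at (shifted F)`_m.
Proof.
pose x : L := xP%:~R.
have shiftedE : map_poly value_at (shifted F) = curve_poly a L \Po (x%:P - 'X).
  rewrite /shifted map_comp_poly rmorphB /= map_polyC map_polyX /= -map_poly_comp.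
  congr (_ \Po (_%:P - _)); first by rewrite /horner_eval hornerX.
  by apply: eq_map_poly => c; rewrite /= /horner_eval hornerC.
rewrite -coef_map shiftedE -coef_comp_opp /local_poly -comp_polyA.
by congr (_ \Po _)`_m; rewrite comp_polyB comp_polyC comp_polyX opprK addrC.
Qed.

Lemma root_series_sqrt : sqrt_at local_poly root_series.
Proof.
have [two0 y0] : 2%:R != 0 :> L /\ yP%:~R != 0 :> L.
  by apply/andP; rewrite -negb_or -mulf_eq0.
split=> //.
- move=> m; rewrite coef_local_poly -(sqrt_seriesP value_at_F u_neq0 m) mulr_sumr.
  apply: eq_bigr => i _; rewrite /root_series mulrACA -exprD; congr (_ * _).
  rewrite -[LHS]signr_odd -[RHS]signr_odd; congr (_ ^+ _).
  by rewrite addSn addnS /= negbK subnKC // -ltnS.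
- by rewrite /root_series expr1 mulN1r opprK.
- rewrite monicE lead_coef_comp ?size_XaddC // lead_coefXaddC expr1n mulr1.
  exact: curve_poly_monic.
- by rewrite size_comp_poly2 ?size_curve_poly // size_XaddC.
Qed.

Lemma cantorP_root_series j : (0 < j)%N ->
  u * value_at (cantorP F j) = (-1) ^+ j.+1 * u ^+ j.*2 * root_series j.
Proof.
case: j => // j _; rewrite /root_series.
have -> : sqrt_series value_at yP%:~R (cantorP (quintic a)) j.+1 =
    value_at (cantorP F j.+1) * (u / u ^+ j.+1.*2).
  by rewrite /sqrt_series expfzDr // expr1z -PoszM mul2n -exprnN.
rewrite mulrACA -expr2 sqrr_sign mul1r mulrCA [u / _]mulrC mulVKf ?expf_neq0 //.
by rewrite mulrC.
Qed.

Lemma cantor_hankel N k : (0 < k)%N ->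
  u ^+ N * value_at (hankelP F k N) =
  (-1) ^+ (N * k.+1) * u ^+ (k.*2 * N + 4 * 'C(N, 2))
    * \det (\matrix_(i < N, j < N) root_series (k + i + j)).
Proof.
move=> k_gt0; rewrite /hankelP -det_map_mx -detZ.
pose r (i : 'I_N) : L := (-1) ^+ i * u ^+ i.*2.
rewrite (det_scale_rank1 (c := (-1) ^+ k.+1 * u ^+ k.*2) (r := r)
   (A := \matrix_(i < N, j < N) root_series (k + i + j))); last first.
  move=> i j; rewrite !mxE cantorP_root_series ?addn_gt0 ?k_gt0 // /r; congr (_ * _).
  by rewrite -!addSn !doubleD !exprD; ring.
have -> : ((-1) ^+ k.+1 * u ^+ k.*2) ^+ N = (-1) ^+ (N * k.+1) * u ^+ (k.*2 * N).
  by rewrite exprMn -!exprM mulnC.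
suff -> : (\prod_i r i) ^+ 2 = u ^+ (4 * 'C(N, 2)) by rewrite exprD !mulrA.
rewrite /r big_split /= !prodrXr exprMn exprAC sqrrN !expr1n mul1r -exprM.
rewrite -bin2_sum big_mkord; under eq_bigr do rewrite -mul2n.
by rewrite -big_distrr /= mulnAC.
Qed.

Lemma bin2_double_add2 N : 'C(N.*2.+2, 2) = (5 * N + 4 * 'C(N, 2)).+1.
Proof.
elim: N => // N IHN; rewrite doubleS binS bin1 binS bin1 IHN binS bin1.
by move: 'C(N, 2) => c; lia.
Qed.

Lemma psi_even N : psi_nat F N.*2.+2 = hankelP F 3 N.
Proof. by rewrite /psi_nat odd_double doubleK. Qed.

Lemma psi_odd N : psi_nat F N.*2.+3 = 4 *: F * hankelP F 4 N.
Proof. by rewrite /psi_nat /= odd_double /= uphalf_double. Qed.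

(** Passing from P_j to the coefficients of Y multiplies Hankel entries by powers of 2y that split
    into a row and a column factor. For odd n the prefactor 4F is (2y)^2, and the remaining signs
    cancel those of [tdet_odd]. *)
Lemma cantor_tdet n : (1 < n)%N ->
  u * value_at (psi_nat F n) = u ^+ 'C(n, 2) * tdet root_series n.
Proof.
move=> n_gt1; have [N defn] : exists N, n = N.*2.+2 \/ n = N.*2.+3.
  exists (n.-2)./2; have := odd_double_half n.-2; case: odd => /=; lia.
have sgn4 : (-1) ^+ (N * 4) = 1 :> L by rewrite -signr_odd oddM andbF.
have sgn5 : (-1) ^+ (N * 5) = (-1) ^+ N :> L by rewrite -signr_odd oddM andbT signr_odd.
case: defn => -> {n n_gt1}; apply: (mulfI (expf_neq0 N u_neq0)); rewrite mulrCA.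
  rewrite psi_even cantor_hankel // sgn4 mul1r tdet_even bin2_double_add2 -/u !mulrA.
  by rewrite -exprS -exprD; congr (_ ^+ _ * _); move: 'C(N, 2) => c; lia.
have -> : value_at (psi_nat F N.*2.+3) = u ^+ 2 * value_at (hankelP F 4 N).
  rewrite psi_odd rmorphM; congr (_ * _).
  rewrite -mul_polyC rmorphM -value_at_F /value_at /= /horner_eval hornerC /u.
  by rewrite exprMn -natrX.
rewrite [u ^+ N * (u ^+ 2 * _)]mulrCA cantor_hankel // sgn5 tdet_odd binS bin1 bin2_double_add2 -/u.
by rewrite !(exprS, exprD, addSn) -addnn !(exprS, exprD); ring.
Qed.

End CantorDeterminants.

(** * Multiples of the class of the point *)

Section CoordRing.

Variables (a : 'I_5 -> int) (L : fieldType).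
Implicit Types (g h : coord_ring a L) (b c : {poly L}) (q : L * L).

Definition mk_fun b c : coord_ring a L := in_qpoly (curve_eqn a L) (b%:P + c *: 'X).

Lemma coefY_mk_fun b c : coefY (mk_fun b c) 0 = b /\ coefY (mk_fun b c) 1 = c.
Proof.
rewrite /coefY in_qpoly_small.
  by rewrite !coefD !coefC !coefZ !coefX /= mulr0 addr0 add0r mulr1.
rewrite mk_monic_curve size_curve_eqn (leq_ltn_trans (size_polyD _ _)) // gtn_max.
rewrite (leq_ltn_trans (size_polyC_leq1 _)) //.
by rewrite (leq_ltn_trans (size_scale_leq _ _)) // size_polyX.
Qed.

Lemma coord_ring_ext g h : coefY g 0 = coefY h 0 -> coefY g 1 = coefY h 1 -> g = h.
Proof. by move=> e0 e1; apply: val_inj; rewrite /= coord_ringE [RHS]coord_ringE e0 e1. Qed.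

Lemma mk_fun_coefY g : g = mk_fun (coefY g 0) (coefY g 1).
Proof. by have [e0 e1] := coefY_mk_fun (coefY g 0) (coefY g 1); apply: coord_ring_ext. Qed.

Lemma mk_funM b c b' c' : mk_fun b c * mk_fun b' c' =
  mk_fun (b * b' + c * c' * curve_poly a L) (b * c' + c * b').
Proof.
have [e0 e1] := coefY_mk_fun b c; have [e0' e1'] := coefY_mk_fun b' c'.
have [E0 E1] := coefYM (mk_fun b c) (mk_fun b' c').
have [F0 F1] := coefY_mk_fun (b * b' + c * c' * curve_poly a L) (b * c' + c * b').
by apply: coord_ring_ext; rewrite ?E0 ?E1 ?F0 ?F1 e0 e1 e0' e1'.
Qed.

Lemma eval_mk_fun b c q : eval (mk_fun b c) q = b.[q.1] + c.[q.1] * q.2.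
Proof. by rewrite evalE; have [-> ->] := coefY_mk_fun b c. Qed.

Lemma mk_fun1 : mk_fun 1 0 = 1.
Proof.
have [e0 e1] := coefY_mk_fun 1 0.
by apply: coord_ring_ext; rewrite ?e0 ?e1 /coefY /= coefC.
Qed.

Lemma mk_funX b n : mk_fun b 0 ^+ n = mk_fun (b ^+ n) 0.
Proof.
elim: n => [|n IHn]; first by rewrite !expr0 mk_fun1.
by rewrite !exprS IHn mk_funM !mulr0 !mul0r !addr0.
Qed.

Lemma local_param_neq0 q : q.2 != 0 -> local_param a q = mk_fun ('X - q.1%:P) 0.
Proof.
move=> /negPf q20; rewrite /local_param q20.
have [e0 e1] := coefY_mk_fun ('X - q.1%:P) 0.
apply: coord_ring_ext; rewrite ?e0 ?e1 /coefY /= coefB !coefC /=; first by [].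
by rewrite subrr.
Qed.

Lemma mk_fun_eq0 b c : (mk_fun b c == 0) = (b == 0) && (c == 0).
Proof. by rewrite coord_ring_eq0; have [-> ->] := coefY_mk_fun b c. Qed.

Lemma coord_mulI g : g != 0 -> injective ( *%R g).
Proof.
move=> g0 h h' eq_gh; apply/eqP; rewrite -subr_eq0; apply: contraTT isT => d0.
by have := coord_mul_neq0 g0 d0; rewrite mulrBr eq_gh subrr eqxx.
Qed.

End CoordRing.

Section PointOrder.

Variables (a : 'I_5 -> int) (L : closedFieldType) (xP yP : int).
Hypothesis P_on_C : yP ^+ 2 = (quintic a).[xP].
Hypothesis u_neq0 : 2%:R * yP%:~R != 0 :> L.

Let x : L := xP%:~R.
Let y : L := yP%:~R.
Let f := local_poly a L xP.
Let s := root_series a L xP yP.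
Let P := reduced_point L P_on_C.

Implicit Types g h : coord_ring a L.

Definition to_cfun g : cfun L :=
  (coefY g 0 \Po ('X + x%:P), coefY g 1 \Po ('X + x%:P)).

Definition of_cfun (p : cfun L) : coord_ring a L :=
  mk_fun a (p.1 \Po ('X - x%:P)) (p.2 \Po ('X - x%:P)).

Let fs : sqrt_at f s := root_series_sqrt P_on_C u_neq0.

Lemma y_neq0 : y != 0.
Proof. by move: u_neq0; rewrite mulf_eq0 negb_or => /andP[]. Qed.

Lemma s0E : s 0%N = y.
Proof. by rewrite /s /root_series expr1 mulN1r opprK. Qed.

Lemma comp_shiftK (b : {poly L}) : (b \Po ('X - x%:P)) \Po ('X + x%:P) = b.
Proof. by rewrite -comp_polyA comp_polyB comp_polyX comp_polyC addrK comp_polyXr. Qed.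

Lemma comp_shiftK' (b : {poly L}) : (b \Po ('X + x%:P)) \Po ('X - x%:P) = b.
Proof. by rewrite -comp_polyA comp_polyD comp_polyX comp_polyC subrK comp_polyXr. Qed.

Lemma of_cfunK p : to_cfun (of_cfun p) = p.
Proof.
rewrite /to_cfun /of_cfun; have [-> ->] := coefY_mk_fun a (p.1 \Po ('X - x%:P)) (p.2 \Po ('X - x%:P)).
by rewrite !comp_shiftK -surjective_pairing.
Qed.

Lemma to_cfunM g h : to_cfun (g * h) = cmul f (to_cfun g) (to_cfun h).
Proof.
have [e0 e1] := coefYM g h.
by rewrite /to_cfun e0 e1 !(comp_polyD, comp_polyM).
Qed.

Lemma nrm_to_cfun g : nrm f (to_cfun g) = coord_norm g \Po ('X + x%:P).
Proof. by rewrite /nrm /coord_norm /= !(comp_polyB, comp_polyM, rmorphXn) /= !expr2. Qed.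

Lemma coef0_ev1 (p : cfun L) : (ev s 1 p)`_0 = p.1`_0 + p.2`_0 * y.
Proof. by rewrite /ev coefD coef0M coef_poly /= s0E. Qed.

Lemma coef0_shift (b : {poly L}) : (b \Po ('X + x%:P))`_0 = b.[x].
Proof. by rewrite -horner_coef0 horner_comp !hornerE. Qed.

Lemma eval_to_cfun g : eval g (x, y) = (ev s 1 (to_cfun g))`_0.
Proof. by rewrite evalE coef0_ev1 /= !coef0_shift. Qed.

Lemma coeff_reduced_div n (Q : point a L) :
  coeff Q (val (reduced_div L P_on_C *+ n)) = (n%:Z * ((P == Q)%:R - (None == Q)%:R))%R.
Proof.
rewrite raddfMn /= coeffMn coeffB !coeffU !mul1r -/P.
by rewrite -[n%:Z]natz mulr_natl.
Qed.

Lemma generates_principal n p : generates f s n p -> (0 < n)%N ->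
  is_div (of_cfun p) 1 (val (reduced_div L P_on_C *+ n)).
Proof.
move=> gp n_gt0; have unit_p := generates_unit fs gp; have p0 := generates_neq0 gp.
have [c c0 [nrm_p vp]] := gp; set g := of_cfun p.
have gE : to_cfun g = p := of_cfunK p.
have norm_g : coord_norm g = c *: ('X - x%:P) ^+ n.
  rewrite -[LHS]comp_shiftK' -nrm_to_cfun gE nrm_p comp_polyZ comp_Xn_poly.
  by [].
have g0 : g != 0.
  by rewrite -coord_norm_eq0 norm_g scaler_eq0 negb_or c0 expf_neq0 // polyXsubC_eq0.
have ev_conj : eval g (x, - y) != 0.
  rewrite evalE /= mulrN -mulNr -!coef0_shift -[X in X + _]/(to_cfun g).1`_0.
  by rewrite -[X in - X * _]/(to_cfun g).2`_0 gE -coefN -(coef0_ev1 (cconj p)).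
split=> //; first exact: oner_neq0.
case=> [q|]; last first.
  exists (- n%:Z), 0; split; rewrite /order_at.
  - congr (- _%:Z); apply/esym/succn_inj; rewrite -coord_norm_pole // norm_g.
    by rewrite size_scale // size_exp_XsubC.
  - by rewrite pole_order1.
  - by rewrite coeff_reduced_div /= sub0r mulrN1 subr0.
have one_order (r : L * L) : affine_order (1 : coord_ring a L) r 0.
  by exists 1, 1; rewrite eval1 oner_neq0 expr0.
exists (n%:Z * (P == Some q)%:R), 0; rewrite coeff_reduced_div /= !subr0; split=> //; last by exists 0%N.
have [Pq|nPq] := eqVneq P (Some q).
  exists n; rewrite ?mulr1 //.
  have -> : val q = (x, y) by case: Pq => <-.
  (* At P the conjugate of g is a unit, and its product with g is c (X - x)^n, where X - x is the
     local parameter. *)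
  exists (mk_fun a c%:P 0), (mk_fun a (coefY g 0) (- coefY g 1)); split.
  - by rewrite eval_mk_fun /= !hornerE.
  - rewrite eval_mk_fun /= hornerN -(coef0_shift (coefY g 0)) -(coef0_shift (coefY g 1)).
    rewrite -[X in X + _]/(to_cfun g).1`_0 -[X in - X * _]/(to_cfun g).2`_0 gE.
    by rewrite -coefN -(coef0_ev1 (cconj p)).
  - rewrite local_param_neq0 ?y_neq0 // mk_funX [in LHS](mk_fun_coefY g).
    have [e0 e1] := coefY_mk_fun a (coefY g 0) (coefY g 1).
    rewrite !mk_funM e0 e1 !mulr0 !mul0r !addr0.
    congr (mk_fun a _ _); last by ring.
    by rewrite [RHS]mulrC mul_polyC -norm_g /coord_norm; ring.
exists 0%N; first by rewrite mulr0.
exists g, 1; rewrite eval1 oner_neq0 expr0 !mul1r; split=> //.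
have /eqP eq_q := valP q.
have norm_q : (coord_norm g).[(val q).1] =
    eval g (val q) * ((coefY g 0).[(val q).1] - (coefY g 1).[(val q).1] * (val q).2).
  by rewrite evalE /coord_norm !hornerE -eq_q; ring.
(* The norm has no zero away from x. Above x the only point other than P is (x, -y), where g is
   nonzero by [ev_conj]. *)
have [q1x|nq1x] := eqVneq (val q).1 x; last first.
  apply: contraNneq nq1x => evq; move: norm_q.
  rewrite evq mul0r norm_g hornerZ horner_exp hornerXsubC => /eqP.
  by rewrite mulf_eq0 (negPf c0) expf_eq0 n_gt0 /= subr_eq0.
have /eqP : (val q).2 ^+ 2 = y ^+ 2.
  by rewrite eq_q q1x; apply/esym/eqP/(reduced_pointP L P_on_C).
rewrite eqf_sqr => /orP[] /eqP q2; last by rewrite [val q]surjective_pairing q1x q2.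
case/eqP: nPq; congr Some; apply: val_inj.
by rewrite [RHS]surjective_pairing q1x q2.
Qed.

End PointOrder.

Lemma closed_single_root (L : closedFieldType) (p : {poly L}) x :
  (forall z, root p z -> z = x) -> p = lead_coef p *: ('X - x%:P) ^+ (size p).-1.
Proof.
have [r defp] := closed_field_poly_normal p => rootx.
have [->|p0] := eqVneq p 0; first by rewrite lead_coef0 scale0r.
have r_x : r = nseq (size r) x.
  apply/all_pred1P/allP => z zr /=; apply/eqP/rootx.
  by rewrite defp rootZ ?lead_coef_eq0 // root_prod_XsubC.
rewrite {1}defp r_x big_nseq iter_mulr_1; congr (_ *: _ ^+ _).
by rewrite [in RHS]defp size_scale ?lead_coef_eq0 // size_prod_XsubC.
Qed.

Section RegularFunctions.

Variables (a : 'I_5 -> int) (L : closedFieldType).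
Hypothesis two_neq0 : 2%:R != 0 :> L.
Implicit Types (g h : coord_ring a L) (q : L * L).

Definition on_curve q := q.2 ^+ 2 == (curve_poly a L).[q.1].

Definition affine_point := {q : L * L | q.2 ^+ 2 == (curve_poly a L).[q.1]}.

Definition locally_divides h g := forall q, on_curve q ->
  exists s t : coord_ring a L, eval t q != 0 /\ t * g = h * s.

Lemma curve_point (x : L) : exists y, on_curve (x, y).
Proof.
have /closed_rootP[y] : size ('X^2 - (curve_poly a L).[x]%:P) != 1%N by rewrite size_XnsubC.
by rewrite /root !hornerE subr_eq0 => ?; exists y.
Qed.

(** Divisibility can be checked locally: above a root x0 of H, local divisibility makes X - x0
    divide both coefficients of g, and one cancels it from H and g. *)
Lemma locally_divides_poly n (H : {poly L}) g : (size H <= n)%N -> H != 0 ->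
  locally_divides (mk_fun a H 0) g -> exists g', g = mk_fun a H 0 * g'.
Proof.
elim: n H g => [|n IHn] H g szH H0 divHg.
  by move: szH; rewrite leqn0 size_poly_eq0 (negPf H0).
have [/eqP/size_poly1P[c c0 ->]|/closed_rootP[x0 rootH]] := eqVneq (size H) 1%N.
  exists (mk_fun a c^-1%:P 0 * g); rewrite mulrA mk_funM !mulr0 !mul0r !addr0 -polyCM.
  by rewrite divff // mk_fun1 mul1r.
have evalH y0 : eval (mk_fun a H 0) (x0, y0) = 0.
  by rewrite eval_mk_fun /= (eqP rootH) !hornerE.
have zero_eval y0 : on_curve (x0, y0) -> eval g (x0, y0) = 0.
  move=> q_on; have [s [t [t0 /(congr1 (fun g => eval g (x0, y0)))]]] := divHg _ q_on.
  rewrite !evalM // evalH mul0r => /eqP.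
  by rewrite mulf_eq0 (negPf t0) => /eqP.
have [y0 q_on] := curve_point x0.
have q_on' : on_curve (x0, - y0) by rewrite /on_curve /= sqrrN.
have [root0 root1] : root (coefY g 0) x0 /\ root (coefY g 1) x0.
  (* If y0 = 0, there is only one point above x0, and the value of g there gives just the first
     coefficient. The second one follows from the coefficient of Y in t g = H s. *)
  have [y00|y00] := eqVneq y0 0.
    have := zero_eval _ q_on; rewrite evalE /= y00 mulr0 addr0 => g00.
    split; first by apply/eqP.
    have [s [t [t0 tg]]] := divHg _ q_on.
    have [_ e1] := coefYM t g; have [_] := coefYM (mk_fun a H 0) s.
    have [-> ->] := coefY_mk_fun a H 0; rewrite -tg e1 mul0r addr0.
    move/(congr1 (horner^~ x0)); rewrite !hornerE g00 (eqP rootH) mul0r mulr0 addr0.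
    move/eqP; rewrite mulf_eq0 => /orP[t00|//].
    by case/eqP: t0; rewrite evalE /= y00 mulr0 addr0 (eqP t00).
  have := zero_eval _ q_on; have := zero_eval _ q_on'; rewrite !evalE /= /root.
  move: (coefY g 0).[x0] (coefY g 1).[x0] => A B e1 e2.
  have A0 : 2%:R * A = (A + B * y0) + (A + B * - y0) by ring.
  have B0 : 2%:R * B * y0 = (A + B * y0) - (A + B * - y0) by ring.
  move/eqP: A0; move/eqP: B0; rewrite e1 e2 addr0 subr0 !mulf_eq0.
  by rewrite (negPf two_neq0) (negPf y00) orbF /= => -> ->.
have [/factor_theorem[b gb] /factor_theorem[c gc]] := (root0, root1).
have /factor_theorem[H' defH] := rootH.
pose l := mk_fun a ('X - x0%:P) 0.
have l0 : l != 0 by rewrite mk_fun_eq0 polyXsubC_eq0.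
have def_g : g = l * mk_fun a b c.
  rewrite [LHS]mk_fun_coefY gb gc /l mk_funM !mul0r !addr0.
  by congr mk_fun; rewrite mulrC.
have def_h : mk_fun a H 0 = l * mk_fun a H' 0.
  by rewrite /l mk_funM !mul0r mulr0 !addr0 defH mulrC.
have H'0 : H' != 0 by apply: contraNneq H0 => H'0; rewrite defH H'0 mul0r.
have szH' : (size H' <= n)%N.
  by move: szH; rewrite defH size_mul ?polyXsubC_eq0 // size_XsubC addn2.
have [|g' g'E] := IHn H' (mk_fun a b c) szH' H'0.
  move=> q /divHg[s [t [t0 tg]]]; exists s, t; split=> //.
  apply: (coord_mulI l0); rewrite mulrCA -def_g tg def_h; ring.
by exists g'; rewrite def_g g'E def_h mulrA.
Qed.

(** Multiplication by the conjugate of h reduces division by h to division by its norm, a polynomial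
    in X. *)
Lemma locally_divides_divides g h : h != 0 -> locally_divides h g ->
  exists g', g = h * g'.
Proof.
move=> h0 div_hg; pose hbar := mk_fun a (coefY h 0) (- coefY h 1).
have hhbar : h * hbar = mk_fun a (coord_norm h) 0.
  rewrite [X in X * _](mk_fun_coefY h) mk_funM; congr mk_fun; rewrite /coord_norm; ring.
have N0 : coord_norm h != 0 by rewrite coord_norm_eq0.
have hbar0 : hbar != 0.
  apply: contraNneq N0 => hbar0; move: hhbar; rewrite hbar0 mulr0 => /esym/eqP.
  by rewrite mk_fun_eq0 => /andP[].
have [|g' gE] := locally_divides_poly (leqnn _) N0 (g := g * hbar).
  move=> q /div_hg[s [t [t0 tg]]]; exists s, t; split=> //.
  by rewrite mulrA tg -hhbar; ring.
exists g'; apply: (coord_mulI hbar0); rewrite mulrC gE -hhbar; ring.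
Qed.

(** A rational function without poles on the affine curve belongs to the coordinate ring. *)
Lemma is_div_quotient g h D : is_div g h D -> (forall q : affine_point, 0 <= coeff (Some q) D) ->
  exists g', [/\ g = h * g', g' != 0 &
    forall q : affine_point, affine_order g' (val q) `|coeff (Some q) D|%N].
Proof.
move=> [g0 h0 divD] D_ge0.
have local (q : affine_point) : exists s t, [/\ eval s (val q) != 0, eval t (val q) != 0 &
    t * g = h * (local_param a (val q) ^+ `|coeff (Some q) D|%N * s)].
  have [m [k [[m' ->] [s [t [s0 t0 tg]]] [k' ->] [s' [t' [s'0 t'0 t'h]]] cD]]] := divD (Some q).
  have := D_ge0 q; rewrite cD subr_ge0 => le_km.
  exists (s * t'), (t * s'); have q_on := valP q.
  rewrite !evalM // !mulf_neq0 //; split=> //.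
  have -> : `|m'%:Z - k'%:Z|%N = (m' - k')%N by rewrite distnEl.
  rewrite -mulrA mulrCA tg -(subnKC (le_km : (k' <= m')%N)) addKn exprD.
  transitivity (local_param a (val q) ^+ (m' - k') * s * (t' * h)); last by ring.
  by rewrite t'h; ring.
have [|g' def_g] := locally_divides_divides h0 (g := g).
  by move=> q q_on; have [s [t [_ t0 tg]]] := local (exist _ q q_on); eexists; exists t; split; last exact: tg.
exists g'; split=> //.
  by apply: contraNneq g0 => g'0; rewrite def_g g'0 mulr0.
move=> q; have [s [t [s0 t0 tg]]] := local q; exists s, t; split=> //.
by apply: (coord_mulI h0); rewrite -tg def_g; ring.
Qed.

End RegularFunctions.

Section PrincipalMultiples.

Variables (a : 'I_5 -> int) (L : closedFieldType) (xP yP : int).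
Hypothesis P_on_C : yP ^+ 2 = (quintic a).[xP].
Hypothesis u_neq0 : 2%:R * yP%:~R != 0 :> L.

Let x : L := xP%:~R.
Let y : L := yP%:~R.
Let f := local_poly a L xP.
Let s := root_series a L xP yP.

Lemma ev_fst n (b : {poly L}) : ev s n (b, 0) = b.
Proof. by rewrite /ev mul0r addr0. Qed.

(** The quotient g' of g by h is regular on the affine curve, with pole order n and no zero except
    P, so its norm is a constant times (X - x)^n. *)
Lemma principal_generates n g h : (0 < n)%N ->
  is_div g h (val (reduced_div L P_on_C *+ n)) -> exists p, generates f s n p.
Proof.
move=> n_gt0 div_gh; have [g0 h0 _] := div_gh.
have two0 : 2%:R != 0 :> L by move: u_neq0; rewrite mulf_eq0 negb_or => /andP[].
have y0 : y != 0 by move: u_neq0; rewrite mulf_eq0 negb_or => /andP[].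
have [|g' [def_g g'0 ord_g']] := is_div_quotient two0 div_gh.
  by move=> q; rewrite coeff_reduced_div /= subr0 mulr_ge0.
pose P : affine_point a L := exist _ (x, y) (reduced_pointP L P_on_C).
have eval_neq0 (q : affine_point a L) : q != P -> eval g' (val q) != 0.
  move=> neqP; have := ord_g' q; rewrite coeff_reduced_div /= subr0.
  rewrite (_ : (reduced_point L P_on_C == Some q) = false); last first.
    by apply/eqP => -[eqPq]; case/eqP: neqP; apply: val_inj; rewrite -eqPq.
  rewrite mulr0 => -[t [u [t0 u0]]]; rewrite expr0 mul1r => ug.
  apply: contraNneq t0 => ev0; rewrite -ug evalM ?(valP q) //.
  by rewrite ev0 mulr0.
have pole_g' : pole_order g' = n.
  have [_ _ /(_ None)[m [k [-> -> ]]]] := div_gh.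
  rewrite coeff_reduced_div /= def_g pole_orderM // => /eqP; lia.
pose N := coord_norm g'.
have size_N : size N = n.+1 by rewrite coord_norm_pole // pole_g'.
have N0 : N != 0 by rewrite coord_norm_eq0.
(* The norm at z is the product of the values of g' at the two points above z, both different from P
   when z is not x. *)
have rootN z : root N z -> z = x.
  move=> /eqP rootz; have [w q_on] := curve_point a z.
  have q_on' : on_curve a (z, - w) by rewrite /on_curve /= sqrrN.
  apply/eqP; apply: contraTT isT => nezx.
  have evq := eval_neq0 (exist _ (z, w) q_on); have evq' := eval_neq0 (exist _ (z, - w) q_on').
  have neP w' (on' : on_curve a (z, w')) : exist _ (z, w') on' != P :> affine_point a L.
    by apply: contraNneq nezx => -[->].
  have := mulf_neq0 (evq (neP _ _)) (evq' (neP _ _)); case/negP; apply/eqP.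
  rewrite !evalE /= -[RHS]rootz /N /coord_norm !hornerE -(eqP q_on) /=; ring.
have def_N := closed_single_root rootN; rewrite size_N /= in def_N.
exists (to_cfun xP g'); exists (lead_coef N); first by rewrite lead_coef_eq0.
split.
  rewrite nrm_to_cfun -/N {1}def_N comp_polyZ rmorphXn /= comp_polyB comp_polyX comp_polyC.
  by rewrite addrK.
have := ord_g' P; rewrite coeff_reduced_div /= subr0.
rewrite (_ : (reduced_point L P_on_C == Some P) = true); last first.
  by apply/eqP; congr Some; apply: val_inj.
rewrite mulr1 absz_nat => -[t [u [t0 u0 ug]]].
have vX : vanish s n ('X^n, 0) by rewrite /vanish ev_fst.
have fsq := root_series_sqrt P_on_C u_neq0.
have vug : vanish s n (to_cfun xP (u * g')).
  rewrite ug to_cfunM -[n in vanish _ n _]addn0 (vanishM fsq) ?vanish0 //.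
  rewrite local_param_neq0 // mk_funX /to_cfun.
  have [-> ->] := coefY_mk_fun a (('X - x%:P) ^+ n) 0.
  by rewrite comp_poly0 rmorphXn /= comp_polyB comp_polyX comp_polyC addrK.
move: vug; rewrite to_cfunM /vanish (dvdp_congr (ev_cmul fsq _ _ _)) dvd_XnMl //.
by rewrite -/s (coef_ev s _ (ltnSn 0) n_gt0) /s -eval_to_cfun.
Qed.

End PrincipalMultiples.

(** * Finiteness of the order *)

Section FiniteField.

Variables (K : finFieldType) (f : {poly K}) (s : nat -> K).
Hypothesis fs : sqrt_at f s.

(** There are n + 1 basis functions and only n linear conditions. *)
Lemma exists_vanish n :
  exists p : cfun K, [/\ p != 0, (size (wt p) <= pord n.+1)%N & vanish s n p].
Proof.
pose A := \matrix_(i < n.+1, k < n) (ev s n (bas K i))`_k.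
have ker0 : nz_row (kermx A) != 0.
  rewrite nz_row_eq0 kermx_eq0 /row_free neq_ltn ltnS.
  by rewrite (rank_leq_col A).
set a := nz_row _ in ker0.
have aA : a *m A = 0 by apply/sub_kermxP/nz_row_sub.
exists (\sum_(j < n.+1) a 0 j *: bas K j); split.
- apply: contraNneq ker0 => p0; apply/eqP/rowP => i; rewrite mxE.
  by rewrite -(coef_wt_sum (fun j => a 0 j)) p0 linear0 coef0.
- rewrite linear_sum; apply: (leq_trans (size_sum _ _ _)).
  apply/bigmax_leqP => j _; rewrite linearZ /= wt_bas.
  by rewrite (leq_trans (size_scale_leq _ _)) // size_polyXn pord_lt.
apply/dvd_XnP => k ltkn; rewrite linear_sum coef_sum.
transitivity ((a *m A) 0 (Ordinal ltkn)); last by rewrite aA mxE.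
by rewrite [RHS]mxE; apply: eq_bigr => j _; rewrite linearZ /= coefZ mxE.
Qed.

Lemma exists_vanish_cofactor n : (1 < n)%N -> exists (p : cfun K) (U : {poly K}),
  [/\ vanish s n p, nrm f p = 'X^n * U, U != 0 & (size U <= 3)%N].
Proof.
move=> n_gt1; have [p [p0 szp vp]] := exists_vanish n.
have N0 := nrm_neq0 (sqrt_monic fs) (sqrt_size fs) p0.
have : 'X^n %| nrm f p by rewrite -(dvdp_congr (vanish_nrm fs n p)) dvdp_mulr.
move=> /dvdpP[U defN]; exists p, U; rewrite mulrC.
have U0 : U != 0 by apply: contraNneq N0 => U0; rewrite defN U0 mul0r.
split=> //; have := szp; rewrite -(size_nrm (sqrt_monic fs) (sqrt_size fs) p0) defN.
by rewrite size_mulXn // /pord ltnNge ltnS n_gt1 /= -[n.+3]addn3 leq_add2l.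
Qed.

(** Modulo U, the product of p' with the conjugate of p is that of p with its own conjugate, the
    norm of p, hence 0. So p and p' have the same zeros besides P, and k has zeros only above v =
    0. *)
Lemma congruent_cofactor n n' p p' U : nrm f p = 'X^n * U -> nrm f p' = 'X^n' * U ->
    U != 0 -> p.1 %% U = p'.1 %% U -> p.2 %% U = p'.2 %% U ->
  exists k, cmul f p' (cconj p) = scal U k /\ nrm f k = 'X^(n + n').
Proof.
move=> nrm_p nrm_p' U0 e1 e2.
have dvdU (b b' : {poly K}) : b %% U = b' %% U -> exists h, b' = b + U * h.
  move=> eqb; exists (b' %/ U - b %/ U).
  by rewrite [LHS](divp_eq b' U) {1}(divp_eq b U) eqb; ring.
have [h1 def1] := dvdU _ _ e1; have [h2 def2] := dvdU _ _ e2.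
pose k : cfun K := ('X^n, 0) + cmul f (h1, h2) (cconj p).
have defk : cmul f p' (cconj p) = scal U k.
  apply: injective_projections; rewrite /= def1 def2.
    by rewrite mulrDr [U * 'X^n]mulrC -nrm_p /nrm; ring.
  by rewrite add0r; ring.
exists k; split=> //; apply: (mulfI (expf_neq0 2 U0)).
by rewrite -nrm_scal -defk nrmM nrm_conj nrm_p nrm_p' exprD; ring.
Qed.

(* Indices are multiples of 5 so that the quotient k of two congruent         *)
(* functions vanishes at P to more than half the degree of its norm.          *)
Lemma exists_generates : exists n p, (0 < n)%N /\ generates f s n p.
Proof.
pose T := ('rV[K]_3 * ('rV[K]_3 * 'rV[K]_3))%type.
pose N := #|{: T}|.
have /fin_all_exists2[p] : forall i : 'I_N.+1, exists2 p : cfun K,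
    vanish s (5 * i + 5) p & exists U : {poly K},
    [/\ nrm f p = 'X^(5 * i + 5) * U, U != 0 & (size U <= 3)%N].
  move=> i; have [|p [U [vp nrm_p U0 szU]]] := @exists_vanish_cofactor (5 * i + 5).
    by lia.
  by exists p => //; exists U.
move=> vp /fin_all_exists[U PU].
pose data (i : 'I_N.+1) : T :=
  (poly_rV (U i), (poly_rV ((p i).1 %% U i), poly_rV ((p i).2 %% U i))).
have [/injectiveP inj|/injectivePn[i [j neij]]] := boolP (injectiveb data).
  by have := leq_card _ inj; rewrite card_ord ltnn.
wlog ltij : i j neij / (i < j)%N.
  move=> IH; have [lt|lt|eqij] := ltngtP i j; first exact: IH.
    by move=> /esym; apply: IH; rewrite // eq_sym.
  by case/eqP: neij; apply: val_inj.
have [nrm_i Ui0 szi] := PU i; have [nrm_j Uj0 szj] := PU j.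
have inj_rV (b b' : {poly K}) : (size b <= 3)%N -> (size b' <= 3)%N ->
    poly_rV b = poly_rV b' :> 'rV_3 -> b = b'.
  by move=> sz sz' eqb; rewrite -(poly_rV_K sz) eqb poly_rV_K.
have szmod (b V : {poly K}) : V != 0 -> (size V <= 3)%N -> (size (b %% V)%R <= 3)%N.
  by move=> V0; apply: leq_trans; rewrite ltnW // ltn_modp.
case=> /inj_rV eqU /inj_rV eq1 /inj_rV eq2.
have {}eqU := eqU szi szj.
have {}eq1 := eq1 (szmod _ _ Ui0 szi) (szmod _ _ Uj0 szj).
have {}eq2 := eq2 (szmod _ _ Ui0 szi) (szmod _ _ Uj0 szj).
rewrite -eqU in nrm_j eq1 eq2.
have [k [defk nrm_k]] := congruent_cofactor nrm_i nrm_j Ui0 eq1 eq2.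
(* Of the 5 j + 5 zeros at P, division by U costs at most two. *)
have vk : vanish s (5 * j + 3) k.
  have le : (5 * j + 3 <= 5 * j + 5)%N by rewrite leq_add2l.
  rewrite (vanishE s k le); apply: (dvd_Xn_small (k := 2) Ui0 szi).
  rewrite -addnA -ev_scal -defk.
  by have := vanishM fs (vp j) (vanish0 s (cconj (p i))); rewrite addn0.
rewrite -[RHS]scale1r in nrm_k.
have [|m [e [q [m0 _ _ gq]]]] := extract_generator fs (oner_neq0 K) nrm_k vk.
  by move: ltij; clear; lia.
by exists m, q.
Qed.

End FiniteField.

(** * Periodicity *)

Section Periods.

Variables (T : Type) (b : int -> T).

Lemma is_period_mul s k n : is_period b s -> b (n + (k * s)%N%:Z) = b n.
Proof.
case=> _ per; elim: k => [|k IHk]; first by rewrite mul0n addr0.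
by rewrite mulSn addnC PoszD addrA per.
Qed.

Lemma period_dvd s : is_period b s -> (period b %| s)%N.
Proof.
move=> per_s; have [per_b _] := leastP per_s; rewrite -/(period b) in per_b.
rewrite /dvdn; apply: contraT; rewrite -lt0n => r_gt0.
have per_r : is_period b (s %% period b)%N.
  split=> // n; rewrite -(is_period_mul (s %/ period b) _ per_b) -addrA -PoszD addnC.
  by rewrite -divn_eq; case: per_s.
have [_] := leastP per_r; rewrite -/(period b) leqNgt ltn_mod.
by case: per_b => ->.
Qed.

End Periods.

Lemma zorder_dvd (V : zmodType) (x : V) N : (0 < N)%N -> x *+ N = 0 ->
  (0 < zorder x)%N /\ forall n, x *+ n = 0 <-> (zorder x %| n)%N.
Proof.
move=> N_gt0 xN; pose Q n := (0 < n)%N /\ x *+ n = 0.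
have [[m_gt0 xm] _] := @leastP Q N (conj N_gt0 xN).
rewrite -/(zorder x) in m_gt0 xm; split=> // n; split=> [xn|/dvdnP[k ->]]; last first.
  by rewrite mulnC mulrnA xm mul0rn.
rewrite /dvdn; apply: contraT; rewrite -lt0n => r_gt0.
have xr : x *+ (n %% zorder x) = 0.
  by move: xn; rewrite {1}(divn_eq n (zorder x)) mulrnDr mulnC mulrnA xm mul0rn add0r.
have [_] := @leastP Q _ (conj r_gt0 xr).
by rewrite -/(zorder x) leqNgt ltn_mod m_gt0.
Qed.

Section QuasiPeriodic.

Variables (K : fieldType) (C : int -> K) (m : nat) (A B : K).
Hypothesis C_odd : forall n, C (- n) = - C n.
Hypotheses (C0 : C 0%N = 0) (C1 : C 1%N = 0).
Hypothesis C2 : C 2%N != 0.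
Hypotheses (m_ge4 : (3 < m)%N) (A0 : A != 0).
Hypothesis C_shift : forall n : nat, (1 < n)%N -> C (m + n)%N = B * A ^+ n * C n.
Hypothesis C_reflect : forall n : nat, (1 < n)%N -> (n + 1 < m)%N ->
  A ^+ n * C (m - n)%N = - B * C n.
Hypothesis C_m : [/\ C m.-1 = 0, C m = 0 & C m.+1 = 0].

(** Reflecting the index 2 to m - 2 and back multiplies C 2 by B^2 / A^m. *)
Lemma quasi_period_square : B ^+ 2 = A ^+ m.
Proof.
have e1 := C_reflect (n := 2) isT; have e2 := C_reflect (n := m - 2).
rewrite subKn in e2; last by lia.
have {}e1 := e1 _; have {}e1 : A ^+ 2 * C (m - 2)%N = - B * C 2%N by apply: e1; lia.
have {}e2 : A ^+ (m - 2) * C 2%N = - B * C (m - 2)%N by apply: e2; lia.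
apply: (mulIf C2); rewrite -[m in RHS](subnK (_ : 2 <= m)%N); last by lia.
rewrite addnC exprD -[RHS]mulrA e2 mulrCA e1; ring.
Qed.

(** For negative indices above -m the oddness of C turns translation into reflection; below -m it is
    the inverse of a translation at a positive index, and B^2 = A^m reconciles the constants. The
    remaining indices meet the zeros of C near 0 and m. *)
Lemma quasi_period (n : int) : C (n + m%:Z) = B * A ^ n * C n.
Proof.
have [Cm_pred Cm Cm_succ] := C_m.
case: n => [[|[|n]]|n].
- by rewrite add0r Cm C0 mulr0.
- by rewrite addrC -PoszD addn1 Cm_succ C1 mulr0.
- by rewrite addrC -PoszD C_shift.
rewrite NegzE C_odd; move: n => [|n].
  by rewrite C1 oppr0 mulr0 addrC subzn 1?ltnW ?subn1 ?Cm_pred //; lia.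
move: n.+1 (ltn0Sn n) => {}n n_gt0.
have [lt_nm|lt_mn|eq_nm] := ltngtP n.+1 m.
- rewrite addrC subzn 1?ltnW //; have [e1|ne1] := eqVneq n.+2 m.
    have n1 : n.+1 = m.-1 by rewrite -e1.
    by rewrite n1 Cm_pred oppr0 mulr0 -e1 /= subSnn C1.
  apply: (mulfI (expf_neq0 n.+1 A0)); rewrite C_reflect //; last by lia.
  by rewrite -exprnN; field; rewrite expf_neq0.
- have [e1|ne1] := eqVneq n.+1 m.+1.
    by rewrite e1 Cm_succ oppr0 mulr0 -addn1 PoszD opprD addrAC addNr add0r C_odd C1 oppr0.
  have [i i_gt1 ->] : exists2 i, (1 < i)%N & n.+1 = (m + i)%N.
    by exists (n.+1 - m)%N; lia.
  rewrite C_shift // PoszD opprD addrAC addNr add0r C_odd.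
  rewrite -[- m%:Z - i%:Z]opprD -PoszD -exprnN exprD.
  transitivity (- (B ^+ 2 / A ^+ m * C i)); last by field; rewrite !expf_neq0.
  by rewrite quasi_period_square divff ?mul1r ?expf_neq0.
by rewrite eq_nm Cm oppr0 mulr0 addNr C0.
Qed.

Lemma quasi_period_iter (k : nat) (n : int) :
  C (n + (k * m)%N%:Z) = B ^+ k * (A ^ n) ^+ k * (A ^+ m) ^+ 'C(k, 2) * C n.
Proof.
elim: k => [|k IHk]; first by rewrite addr0 !expr0 !mul1r.
rewrite mulSn addnC PoszD addrA quasi_period IHk expfzDr // -exprnP mulnC exprM.
rewrite binS bin1 exprD !exprS; ring.
Qed.

(** With k = 2q steps the quadratic factor (A^m)^(k(k-1)/2) equals B^(k(k-1)), which is 1 because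
    B^k = 1. *)
Lemma quasi_period_period q : A ^+ q.*2 = 1 -> B ^+ q.*2 = 1 ->
  forall n, C (n + (q.*2 * m)%N%:Z) = C n.
Proof.
move=> Aq Bq n; rewrite quasi_period_iter Bq.
rewrite [(A ^ n) ^+ _]exprnP exprzAC -exprnP Aq exp1rz !mul1r -quasi_period_square -exprM.
have -> : (2 * 'C(q.*2, 2) = q.*2 * q.*2.-1)%N by rewrite -mul_bin_diag bin1.
by rewrite exprM Bq expr1n mul1r.
Qed.

End QuasiPeriodic.

Lemma bin2D i j : ('C(i + j, 2) = 'C(i, 2) + i * j + 'C(j, 2))%N.
Proof.
elim: j => [|j IHj]; first by rewrite muln0 !addn0.
by rewrite addnS !binS !bin1 IHj mulnS; move: 'C(i, 2) 'C(j, 2) (i * j)%N => u v w; lia.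
Qed.

Section TdetQuasiPeriod.

Variables (K : fieldType) (f : {poly K}) (s : nat -> K).
Hypothesis fs : sqrt_at f s.

Lemma generates_monic m p : generates f s m p ->
  exists2 g, generates f s m g & lead_coef (wt g) = 1.
Proof.
move=> gp; have p0 := generates_neq0 gp; have [c c0 [nrm_p vp]] := gp.
set l := lead_coef (wt p); have l0 : l^-1 != 0 by rewrite invr_eq0 lead_coef_eq0 wt_eq0.
exists (l^-1 *: p); last by rewrite linearZ /= lead_coefZ mulVf // -invr_eq0.
exists (l^-1 ^+ 2 * c); first by rewrite mulf_neq0 ?expf_neq0.
split; last by rewrite /vanish linearZ /= dvdpZr.
rewrite -scalerA -nrm_p -!mul_polyC /nrm /= -!mul_polyC polyC_exp; ring.
Qed.

Lemma tdet_quasi_period m p (c : nat -> K) : (4 < m)%N -> generates f s m p ->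
    (forall n, (1 < n)%N -> 2%:R * s 0%N * c n = (2%:R * s 0%N) ^+ 'C(n, 2) * tdet s n) ->
  exists A B : K, [/\ A != 0, B != 0,
    forall n, (1 < n)%N -> c (m + n)%N = B * A ^+ n * c n
    & forall n, (1 < n)%N -> (n + 1 < m)%N -> A ^+ n * c (m - n)%N = - B * c n].
Proof.
move=> m_ge5 /generates_monic[g gg lead_g] c_tdet.
set u := 2%:R * s 0%N in c_tdet *.
have u0 : u != 0 by rewrite mulf_neq0 ?(sqrt_char fs) ?(sqrt_neq0 fs).
set e := lead_exp s m g; set w := wdet s m.
have reflect n : (1 < n)%N -> (n + 1 < m)%N -> [/\ e != 0, w != 0 &
    (u * e) ^+ n * tdet s (m - n) = tdet s n * w].
  move=> n_gt1 lt_nm; have m_nE : (n + (m - n) = m)%N by lia.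
  have mn_gt1 : (1 < m - n)%N by lia.
  have := @reflection _ _ _ fs n (m - n) g n_gt1 mn_gt1; rewrite m_nE.
  move=> /(_ m_ge5 gg lead_g)[theta [thetaE ww refl]]; rewrite -/e -/w -/u in thetaE ww refl.
  (* The inverse of 0 is 0 by convention, so e = 0 would make theta vanish, against [ww]. *)
  have e0 : e != 0.
    apply/eqP => e0; move: ww; rewrite thetaE e0 mulr0 invr0 expr0n.
    rewrite (_ : (m == 0)%N = false); last by lia.
    by rewrite mulr0 mul0r => /eqP; rewrite eq_sym oner_eq0.
  have w0 : w != 0.
    by apply: contra_eq_neq ww => ->; rewrite mulr0 eq_sym oner_neq0.
  split=> //; rewrite -refl thetaE exprVn.
  have v0 : (u * e) ^+ n != 0 by apply: expf_neq0; apply: mulf_neq0.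
  by move: (_ ^+ n) v0 => v v0; field.
have [e0 w0 _] : [/\ e != 0, w != 0 & (u * e) ^+ 2 * tdet s (m - 2) = tdet s 2 * w].
  by apply: reflect => //; lia.
(* From C(m + n, 2) = C(m, 2) + m n + C(n, 2): the term m n goes into A^n and C(m, 2) into B. The
   sign of B is that of [tdet_shift]. *)
exists (u ^+ m * e), (- (w * u ^+ 'C(m, 2))).
split.
- by rewrite mulf_neq0 ?expf_neq0.
- by rewrite oppr_eq0 mulf_neq0 ?expf_neq0.
- move=> n n_gt1; apply: (mulfI u0); rewrite c_tdet; last by lia.
  rewrite mulrCA c_tdet // (tdet_shift fs m_ge5 gg lead_g n_gt1) -/e -/w.
  rewrite bin2D.
  have -> : (u ^+ m * e) ^+ n = u ^+ (m * n) * e ^+ n by rewrite exprMn exprM.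
  rewrite !exprD; ring.
move=> n n_gt1 lt_nm; apply: (mulfI u0); rewrite mulrCA c_tdet; last by lia.
rewrite opprK [RHS]mulrCA c_tdet //.
have [_ _ refl] := reflect n n_gt1 lt_nm.
have -> : (u ^+ m * e) ^+ n = u ^+ (m * n) * e ^+ n by rewrite exprMn exprM.
have expE : (m * n + 'C(m - n, 2) = 'C(m, 2) + 'C(n, 2) + n)%N.
  rewrite -{1 3}(subnK (_ : n <= m)%N); last by lia.
  rewrite bin2D; have : (n * n = 2 * 'C(n, 2) + n)%N.
    by rewrite -mul_bin_diag bin1; case: (n) => // k; rewrite mulnS addnC.
  rewrite mulnDl; move: 'C(_, 2) 'C(n, 2) ((m - n) * n)%N => A B C; lia.
transitivity (u ^+ ('C(m, 2) + 'C(n, 2)) * ((u * e) ^+ n * tdet s (m - n))).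
  rewrite mulrACA -exprD expE !exprD [(u * e) ^+ n]exprMn; ring.
by rewrite refl exprD; ring.
Qed.

End TdetQuasiPeriod.

(** * Reduction modulo p *)

Section BaseChange.

Variables (a : 'I_5 -> int) (k L : fieldType) (iota : {rmorphism k -> L}) (xP yP : int).

Lemma map_local_poly : map_poly iota (local_poly a k xP) = local_poly a L xP.
Proof.
rewrite /local_poly map_comp_poly rmorphD /= map_polyX map_polyC /= rmorph_int.
congr (_ \Po _); rewrite /curve_poly -map_poly_comp.
by apply: eq_map_poly => z; rewrite /= rmorph_int.
Qed.

Lemma map_root_series j : iota (root_series a k xP yP j) = root_series a L xP yP j.
Proof.
rewrite /root_series rmorphM rmorphXn rmorphN1; congr (_ * _).
case: j => [|j]; first by rewrite /= rmorphN rmorph_int.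
by rewrite /sqrt_series /= rmorphM fmorphXz rmorphM !rmorph_int rmorph_nat.
Qed.

Definition map_cfun (p : cfun k) : cfun L := (map_poly iota p.1, map_poly iota p.2).

Lemma map_ev n p :
  ev (root_series a L xP yP) n (map_cfun p) = map_poly iota (ev (root_series a k xP yP) n p).
Proof.
rewrite /ev /= rmorphD rmorphM /=; congr (_ + _ * _); apply/polyP => j.
by rewrite coef_map /ser !coef_poly; case: ifP; rewrite ?raddf0 /= ?map_root_series.
Qed.

(** Generators are found over F_p, where the pigeonhole principle applies, but the Jacobian is
    defined through points over the closure. *)
Lemma map_generates n p : generates (local_poly a k xP) (root_series a k xP yP) n p ->
  generates (local_poly a L xP) (root_series a L xP yP) n (map_cfun p).
Proof.
case=> c c0 [nrm_p vp]; exists (iota c); first by rewrite fmorph_eq0.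
split; last by rewrite /vanish map_ev -(map_polyXn iota) dvdp_map.
rewrite -(map_polyXn iota) -map_polyZ -nrm_p /nrm rmorphB /= !rmorphXn rmorphM rmorphXn /=.
by rewrite map_local_poly.
Qed.

End BaseChange.

Section ReducedClass.

Variables (a : 'I_5 -> int) (L : fieldType) (xP yP : int).
Hypothesis P_on_C : yP ^+ 2 = (quintic a).[xP].

Lemma reduced_class_mul_eq0 n : reduced_class L P_on_C *+ n = 0 <->
  exists g h, is_div g h (val (reduced_div L P_on_C *+ n)).
Proof.
have classMn (D : div0 a L) : div_class (D *+ n) = div_class D *+ n.
  have class0 : div_class (0 : div0 a L) = 0.
    by rewrite -[X in div_class X](subrr 0) div_classB subrr.
  have classD : {morph @div_class a L : E E' / E + E'}.
    move=> E E'; have -> : E + E' = E - (0 - E') by rewrite sub0r opprK.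
    by rewrite !div_classB class0 sub0r opprK.
  elim: n => [|n IHn]; first by rewrite !mulr0n.
  by rewrite !mulrS classD IHn.
split=> [/(congr1 val)|div_gh].
  rewrite raddfMn /= -classMn => /eqP; rewrite div_class_eq0 => /asboolP.
  exact.
apply: val_inj; rewrite raddfMn /= -classMn; apply/eqP; rewrite div_class_eq0.
exact/asboolP.
Qed.

End ReducedClass.

Section ReductionModP.

Variables (a : 'I_5 -> int) (xP yP : int).
Hypothesis P_on_C : yP ^+ 2 = (quintic a).[xP].
Variables (p : nat) (L : closedFieldType) (iota : {rmorphism 'F_p -> L}).
Hypotheses (p_prime : prime p) (p_odd : odd p).

Let c (n : int) : int := (psi (quintic a) n).[xP].
Let C (n : int) : L := (c n)%:~R.
Let D := reduced_class L P_on_C.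

Hypothesis c_neq0 : forall n : nat, (1 < n < 8)%N -> ~~ (p%:Z %| c n)%Z.

Lemma Fp_intr_eq0 (z : int) : (z%:~R == 0 :> 'F_p) = (p %| z)%Z.
Proof. by rewrite (dvdz_pcharf (pchar_Fp p_prime)). Qed.

Lemma C_neq0 (n : nat) : (1 < n < 8)%N -> C n != 0.
Proof. by move=> /c_neq0; rewrite -Fp_intr_eq0 /C -(rmorph_int iota) fmorph_eq0. Qed.

Lemma C_odd n : C (- n) = - C n.
Proof.
rewrite /C /c; case: n => [[|n]|n].
- by rewrite oppr0 horner0 oppr0.
- by rewrite -NegzE hornerN rmorphN.
- by rewrite NegzE opprK /= hornerN rmorphN opprK.
Qed.

(** Because c_3 = 4 F(x_P) = (2 y_P)^2. *)
Lemma double_yP_neq0 : 2%:R * yP%:~R != 0 :> 'F_p.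
Proof.
have := c_neq0 (n := 3) isT; rewrite -Fp_intr_eq0; apply: contraNneq => u0.
rewrite /c [psi _ _]psi_nat3 hornerZ -P_on_C.
have -> : 4 * yP ^+ 2 = (2 * yP) * (2 * yP) :> int by ring.
by rewrite !rmorphM /= u0 mul0r.
Qed.

Lemma double_yP_neq0_L : 2%:R * yP%:~R != 0 :> L.
Proof.
by rewrite -(rmorph_int iota) -(rmorph_nat iota) -rmorphM fmorph_eq0 double_yP_neq0.
Qed.

Let f := local_poly a L xP.
Let s := root_series a L xP yP.
Let fs : sqrt_at f s := root_series_sqrt P_on_C double_yP_neq0_L.

Lemma C_tdet n : (1 < n)%N -> 2%:R * s 0%N * C n = (2%:R * s 0%N) ^+ 'C(n, 2) * tdet s n.
Proof.
have -> : s 0%N = yP%:~R by rewrite /s /root_series expr1 mulN1r opprK.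
exact: (cantor_tdet P_on_C double_yP_neq0_L).
Qed.

Lemma C_eq0 n : (1 < n)%N -> (C n == 0) = (tdet s n == 0).
Proof.
move=> n_gt1; have u0 : 2%:R * s 0%N != 0 by rewrite mulf_neq0 ?(sqrt_char fs) ?(sqrt_neq0 fs).
rewrite -[LHS]orFb -(negPf u0) -mulf_eq0 C_tdet // mulf_eq0 expf_eq0.
by rewrite (negPf u0) andbF.
Qed.

Lemma generatesP n : (0 < n)%N -> D *+ n = 0 <-> exists q, generates f s n q.
Proof.
move=> n_gt0; rewrite /D reduced_class_mul_eq0; split=> [[g [h div_gh]]|[q gq]].
  exact (principal_generates double_yP_neq0_L n_gt0 div_gh).
exists (of_cfun a xP q), 1; exact (generates_principal P_on_C double_yP_neq0_L gq n_gt0).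
Qed.

Lemma reduced_class_torsion : (0 < zorder D)%N /\ forall n, D *+ n = 0 <-> (zorder D %| n)%N.
Proof.
have [n [q [n_gt0 /(map_generates iota) gq]]] :=
  exists_generates (root_series_sqrt P_on_C double_yP_neq0).
by apply: (zorder_dvd n_gt0); apply/(generatesP n_gt0); eexists; apply: gq.
Qed.

Let m := zorder D.

Lemma generates_zorder : exists q, generates f s m q.
Proof. by have [m_gt0 mP] := reduced_class_torsion; apply/(generatesP m_gt0)/mP. Qed.

(** A generator of index m makes c_m vanish if m >= 2, and c_2 if m = 1, whereas c_2, ..., c_7 are
    units modulo p. *)
Lemma zorder_gt7 : (7 < m)%N.
Proof.
have [m_gt0 _] := reduced_class_torsion; have [q gq] := generates_zorder.
have tdet_neq0 n : (1 < n < 8)%N -> tdet s n != 0.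
  by move=> n_lt; have /andP[n_gt1 _] := n_lt; rewrite -C_eq0 // C_neq0.
rewrite ltnNge; apply/negP => le_m7.
have [m1|m1] := eqVneq m 1%N.
  by have := tdet_generatesS fs gq m_gt0; rewrite m1 => /eqP; rewrite (negPf (tdet_neq0 2 isT)).
have lt_m : (1 < m < 8)%N by rewrite ltn_neqAle eq_sym m1 m_gt0.
have /eqP := tdet_neq0 m lt_m; rewrite (tdet_generates fs gq) //.
by move: lt_m; clear; case: (m) => [|[|[|k]]].
Qed.

Lemma C_multiple_zorder : [/\ C m.-1 = 0, C m = 0 & C m.+1 = 0].
Proof.
have m_gt7 := zorder_gt7; have [q gq] := generates_zorder.
have pordE n : (2 < n)%N -> pord n = n.+2 by rewrite /pord leqNgt => /negPf ->.
split; apply/eqP; rewrite C_eq0; try by move: m_gt7; clear; lia.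
- by rewrite (tdet_generates fs gq) ?pordE //; move: m_gt7; clear; lia.
- by rewrite (tdet_generates fs gq) ?pordE //; move: m_gt7; clear; lia.
- by rewrite (tdet_generatesS fs gq) //; move: m_gt7; clear; lia.
Qed.

Lemma Fp_unit_pow (z : 'F_p) : z != 0 -> iota z ^+ p.-1 = 1.
Proof.
move=> z0; rewrite -rmorphXn; apply: (mulfI (_ : iota z != 0)); first by rewrite fmorph_eq0.
rewrite mulr1 -rmorphM -exprS prednK ?prime_gt0 //.
by rewrite -[X in z ^+ X](card_Fp p_prime) expf_card.
Qed.

Lemma zorder_period : is_period (reduce_seq p c) (p.-1 * m)%N.
Proof.
have m_gt7 := zorder_gt7; have [q gq] := generates_zorder.
have m_ge5 : (4 < m)%N by move: m_gt7; clear; lia.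
have [A [B [A0 B0 shift reflect]]] := tdet_quasi_period fs m_ge5 gq C_tdet.
have C2 := C_neq0 (n := 2) isT; have C3 := C_neq0 (n := 3) isT.
(* A and B are only known to lie in L, but B A^n = c_(m+n) / c_n comes from a nonzero element of
   F_p; comparing n = 3 with n = 2 isolates A. *)
have pow1 n : (1 < n < 8)%N -> (B * A ^+ n) ^+ p.-1 = 1.
  move=> n_lt; have /andP[n_gt1 _] := n_lt; have Cn0 := C_neq0 n_lt.
  have -> : B * A ^+ n = iota ((c (m + n)%N)%:~R / (c n)%:~R).
    rewrite fmorph_div !rmorph_int -/(C _) -/(C n) shift //.
    by rewrite mulfK.
  apply: Fp_unit_pow; rewrite -(fmorph_eq0 iota) fmorph_div !rmorph_int -/(C _) -/(C n).
  by rewrite shift // mulfK // mulf_neq0 ?expf_neq0.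
have A1 : A ^+ p.-1 = 1.
  have := pow1 3 isT; rewrite exprS mulrCA exprMn.
  by rewrite pow1 // mulr1.
have B1 : B ^+ p.-1 = 1.
  by have := pow1 2 isT; rewrite exprMn exprAC A1 expr1n mulr1.
have p1E : p.-1 = (p./2).*2.
  by rewrite -[p in LHS]odd_double_half p_odd.
split; first by rewrite muln_gt0 -subn1 subn_gt0 prime_gt1 //; move: m_gt7; clear; lia.
move=> n; apply: (fmorph_inj iota); rewrite /reduce_seq !rmorph_int -/(C _) -/(C n) p1E.
have m_gt3 : (3 < m)%N by move: m_gt7; clear; lia.
apply: (quasi_period_period C_odd _ _ C2 m_gt3 A0 shift reflect C_multiple_zorder).
- by rewrite /C /c horner0.
- by rewrite /C /c horner0.
- by rewrite -p1E.
- by rewrite -p1E.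
Qed.

(** A period t carries the zeros of c at -1, 0 and 1 to t - 1, t and t + 1. It exceeds 3, as
    otherwise one of these indices would be 2, where c is nonzero modulo p; so [generates_of_tdet]
    applies and t D_P = 0. *)
Lemma zorder_dvd_period t : is_period (reduce_seq p c) t -> (m %| t)%N.
Proof.
case=> t_gt0 per.
have perC n : C (n + t%:Z) = C n.
  by rewrite /C -!(rmorph_int iota); congr (iota _); apply: per.
have C0 : C 0%N = 0 by rewrite /C /c horner0.
have C1 : C 1%N = 0 by rewrite /C /c horner0.
have Ct : C t = 0 by rewrite -[t%:Z]add0r perC.
have Ct1 : C t.+1 = 0 by rewrite -addn1 PoszD addrC perC.
have Ct_1 : C t.-1 = 0.
  have -> : t.-1%:Z = - 1 + t%:Z by rewrite -[t in RHS]prednK // -addn1 PoszD addrC addrK.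
  by rewrite perC C_odd C1 oppr0.
have t_gt3 : (3 < t)%N.
  rewrite ltnNge; apply/negP => t_le3; have := C_neq0 (n := 2) isT.
  have [t3|[t2|t1]] : t = 3%N \/ t = 2%N \/ t = 1%N by move: t_gt0 t_le3; clear; lia.
  - by rewrite -[2%N]/(3.-1) -t3 Ct_1 eqxx.
  - by rewrite -t2 Ct eqxx.
  - by rewrite -[2%N]/(1.+1) -t1 Ct1 eqxx.
have [_ mP] := reduced_class_torsion; apply/mP/(generatesP t_gt0).
apply: (generates_of_tdet fs t_gt3); apply/eqP; rewrite -C_eq0 ?Ct ?Ct1 ?Ct_1 ?eqxx //.
all: move: t_gt3; clear; lia.
Qed.

Lemma period_bounds : periodic (reduce_seq p c) /\
  (zorder D %| period (reduce_seq p c))%N /\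
  (period (reduce_seq p c) %| (p - 1) * zorder D)%N.
Proof.
have per := zorder_period; split; first by exists (p.-1 * m)%N.
split; last by rewrite subn1; apply: period_dvd.
by apply: zorder_dvd_period; case: (leastP per).
Qed.

End ReductionModP.

Theorem theorem1p1 (a : 'I_5 -> int) (xP yP : int)
    (P_on_C : yP ^+ 2 = (quintic a).[xP]) (p : nat) :
  let F := quintic a in
  let c := fun n : int => (psi F n).[xP] in
  let d := c 3 * c 4 * c 5 * c 6 * c 7 * (c 4 ^+ 3 - c 3 ^+ 3 * c 5) in
  disc F != 0 -> d != 0 ->
  prime p -> odd p -> ~~ (p%:Z %| disc F)%Z -> ~~ (p%:Z %| d)%Z ->
  periodic (reduce_seq p c) /\
  (zorder (DPbar p P_on_C) %| period (reduce_seq p c))%N /\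
  (period (reduce_seq p c) %| (p - 1) * zorder (DPbar p P_on_C))%N.
Proof.
move=> F c d _ _ p_prime p_odd _ p_d.
have iota : {rmorphism 'F_p -> Fpbar p} := sval (tagged (countable_algebraic_closure 'F_p)).
apply: (@period_bounds _ _ _ _ _ (Fpbar p) iota) => //.
move: p_d; rewrite -!(Fp_intr_eq0 p_prime) /d !rmorphM /= !mulf_eq0 !negb_or.
do 5![case/andP]; move=> c3 c4 c5 c6 c7 _.
have c2 : ((c 2%N)%:~R : 'F_p) != 0.
  by rewrite /c [psi _ _]psi_nat2 hornerC oner_neq0.
by case=> [|[|[|[|[|[|[|[|n]]]]]]]] // _; rewrite -(Fp_intr_eq0 p_prime).
Qed.
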